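(* Let $\mathcal I_h:H^1(\mathcal T^h)\to\mathcal U^{nc}$ be the modified Clément-type interpolation operator defined in the context. There is a constant $C>0$ depending only on the shape-regularity constant $\kappa$ of $\mathcal T^h$ (in particular not on $\alpha$) such that for every $v\in H^1(\mathcal T^h)$: $$\|v-\mathcal I_hv\|_{0,K}\le C\,\frac{h_K}{\alpha_K^{1/2}}\Big(|\!|\!|v|\!|\!|_{\triangle_K}+\sum_{e\in\mathcal E_K^h}\Big(\frac{\alpha_e^-}{h_e}\Big)^{1/2}\big\|[\![v]\!]_e\big\|_{0,e}\Big)\qquad\forall\,K\in\mathcal T^h,$$ and $$\big\|v|_e^+-\pi_ev\big\|_{0,e}\le C\Big(\frac{h_e}{\alpha_e^+}\Big)^{1/2}|\!|\!|v|\!|\!|_{K_e^+}\qquad\forall\,e\in\mathcal E^h.$$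
   Context: $\Omega\subset\mathbb R^2$ is a bounded, open, connected polygonal (Lipschitz) domain with $\partial\Omega=\bar\Gamma_D\cup\bar\Gamma_N$, $\Gamma_D,\Gamma_N$ open and disjoint. $\alpha>0$ is piecewise constant with respect to a partition of $\Omega$ into polygonal subdomains. $\mathcal T^h$ is a conforming triangulation of $\Omega$ into triangles with $h_K\le\kappa\rho_K$ for all $K\in\mathcal T^h$ ($h_K$ diameter of $K$, $\rho_K$ diameter of its largest inscribed circle); subdomain boundaries do not cut through any element, so $\alpha=\alpha_K$ is constant on each $K$; each boundary edge lies in $\bar\Gamma_D$ or $\bar\Gamma_N$. $\mathcal E^h=\mathcal E_I^h\cup\mathcal E_D^h\cup\mathcal E_N^h$ are the edges: interior, on $\bar\Gamma_D$, on $\Gamma_N$; $m_e,h_e$ are the midpoint and length of $e$; $\mathcal E_K^h$ is the set of edges of $K$. $\triangle_K$ is the union of the elements sharing an edge with $K$ (including $K$). $H^1(\mathcal T^h)=\{v\in L^2(\Omega):v|_K\in H^1(K)\ \forall K\in\mathcal T^h\}$. For a union $\omega$ of elements, $|\!|\!|v|\!|\!|_\omega=\big(\sum_{K\subset\omega}\|\alpha^{1/2}\nabla v\|_{0,K}^2\big)^{1/2}$. $\mathcal U^{nc}$ is the Crouzeix–Raviart space of $v\in L^2(\Omega)$ with $v|_K\in P_1(K)$ for all $K$ and $v$ continuous at $m_e$ for all $e\in\mathcal E^h_I$. For $e\in\mathcal E_I^h$, $K_e^\pm$ are the two elements sharing $e$, labelled so that $\alpha_e^+:=\alpha_{K_e^+}\ge\alpha_{K_e^-}=:\alpha_e^-$;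 $v|_e^\pm$ are the traces on $e$ from $K_e^\pm$. For a boundary edge $e$, $K_e^+=K_e$ is the element containing $e$, $v|_e^+$ is the trace from it, and $\alpha_e^\pm=\alpha_{K_e}$. The jump is $[\![v]\!]_e=v|_e^+-v|_e^-$ for $e\in\mathcal E_I^h$, $[\![v]\!]_e=v|_e-g_D$ for $e\in\mathcal E_D^h$ (with $g_D$ the given Dirichlet datum), and $[\![v]\!]_e=0$ for $e\in\mathcal E_N^h$. Interpolation: $\pi_e(v)=\frac1{|K_e^+|}\int_{K_e^+}v\,dx$ for $e\in\mathcal E_I^h$ and $\pi_e(v)=\frac1{|K_e|}\int_{K_e}v\,dx$ for $e\in\mathcal E_D^h\cup\mathcal E_N^h$; $\mathcal I_h(v)=\sum_{e\in\mathcal E^h}(\pi_ev)\phi_e$, where $\phi_e\in\mathcal U^{nc}$ is the nodal basis function equal to $1$ at $m_e$ and $0$ at the midpoints of all other edges. *)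

(* Defs.v *)
(* The plane is R * R, for an arbitrary R : realType. *)
From HB Require Import structures.
From mathcomp Require Import all_boot all_order all_algebra.
From mathcomp Require Import all_classical all_reals all_analysis.

Set Implicit Arguments.
Unset Strict Implicit.
Unset Printing Implicit Defensive.

Import Order.TTheory GRing.Theory Num.Theory.
Import numFieldNormedType.Exports.

Local Open Scope classical_set_scope.
Local Open Scope ring_scope.

Section Plane.
Variable R : realType.
Implicit Types (x y u : R * R) (A D : set (R * R)) (f : R * R -> R).

(* The library norm on R * R is the sup norm, hence a separate Euclidean one. *)
Definition dotp x y : R := x.1 * y.1 + x.2 * y.2.
Definition enorm x : R := Num.sqrt (dotp x x).
Definition edist x y : R := enorm (x - y).

Definition frontier A : set (R * R) := closure A `\` A°.

Definition segment x y : set (R * R) :=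
  [set z | exists2 t : R, 0 <= t <= 1 & z = x + t *: (y - x)].

(* h_K and rho_K: Euclidean diameter, diameter of a largest inscribed disc. *)
Definition diam A : R := sup [set edist p.1 p.2 | p in A `*` A].

Definition indiam A : R :=
  sup [set d | 0 <= d /\ exists c, forall x, edist c x <= d / 2 -> A x].

(* Near each boundary point, in the Cartesian frame (u, u rotated by pi/2)
   centred at that point, Omega is the strict epigraph of a Lipschitz map. *)
Definition lipschitz_domain A : Prop :=
  forall z, frontier A z ->
  exists (u : R * R) (r L : R) (gamma : R -> R),
    [/\ enorm u = 1, 0 < r, L.-lipschitz gamma &
      forall x, edist x z < r ->
        (A x <-> gamma (dotp u (x - z)) < dotp (- u.2, u.1) (x - z))].

Definition polygonal A : Prop :=
  exists s : seq ((R * R) * (R * R)),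
    frontier A = \bigcup_(p in [set` s]) segment p.1 p.2.

Definition polygonal_domain A : Prop :=
  [/\ A !=set0, open A, connected A & bounded_set A] /\ polygonal A.

Definition leb2 := (@lebesgue_measure R \x @lebesgue_measure R)%E.

Definition inL2 D f : Prop :=
  measurable_fun D f /\ leb2.-integrable D (fun x => (f x ^+ 2)%:E).

Definition normL2 D f : R := Num.sqrt (\int[leb2]_(x in D) (f x ^+ 2)).

Definition mean D f : R := (\int[leb2]_(x in D) f x) / fine (leb2 D).

Definition dir (b : bool) : R * R := if b then (0, 1) else (1, 0).
Definition partial (b : bool) f : R * R -> R := fun x => 'D_(dir b) f x.

(* C^infinity: every iterated partial derivative exists and is continuous. *)
Definition smooth f : Prop :=
  forall s : seq bool, let g := foldr partial f s in
    continuous g /\ forall b x, derivable g x (dir b).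

Definition test_function D f : Prop :=
  [/\ smooth f, compact (closure [set x | f x != 0])
    & closure [set x | f x != 0] `<=` D].

Definition weak_gradient D f (g : R * R -> R * R) : Prop :=
  [/\ inL2 D (fun x => (g x).1), inL2 D (fun x => (g x).2) &
    forall phi, test_function D phi ->
      (\int[leb2]_(x in D) (f x * partial false phi x))
        = - (\int[leb2]_(x in D) ((g x).1 * phi x)) /\
      (\int[leb2]_(x in D) (f x * partial true phi x))
        = - (\int[leb2]_(x in D) ((g x).2 * phi x))].

Definition inH1 D f : Prop := inL2 D f /\ exists g, weak_gradient D f g.

Definition grad D f : R * R -> R * R :=
  xget (fun=> 0) [set g | weak_gradient D f g].

End Plane.

(* A mesh is given by a finite type V of vertex names, their positions X, and
   the set T of elements, each element being the set of its three vertices.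
   Edges are two-element subsets of elements. *)
Section Mesh.
Variables (R : realType) (V : finType) (X : V -> R * R).
Implicit Types (s e K : {set V}) (f v : R * R -> R).

Definition hull s : set (R * R) :=
  [set x | exists w : V -> R,
    [/\ forall p, 0 <= w p, \sum_(p in s) w p = 1
      & x = \sum_(p in s) w p *: X p]].

(* Elements are taken open; their boundaries are null sets. *)
Definition elt K : set (R * R) := (hull K)°.

(* The two endpoints of an edge, in the order of [enum]. *)
Definition endpt e (i : nat) : R * R := nth 0 [seq X p | p <- enum e] i.
Definition edge_pt e (t : R) : R * R :=
  endpt e 0 + t *: (endpt e 1 - endpt e 0).
Definition edge_len e : R := edist (endpt e 0) (endpt e 1).
Definition midpt e : R * R := edge_pt e (2^-1).

(* L^2(e) for the arc length measure of e, through its affine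
   parametrization, whose speed is the length of e. *)
Definition inL2e e f : Prop :=
  measurable_fun `[(0 : R), 1] (f \o edge_pt e) /\
  (@lebesgue_measure R).-integrable `[(0 : R), 1]
    (fun t => (f (edge_pt e t) ^+ 2)%:E).

Definition normL2e e f : R :=
  Num.sqrt (edge_len e *
    \int[@lebesgue_measure R]_(t in `[(0 : R), 1]) (f (edge_pt e t) ^+ 2)).

(* t is the trace of v in H^1(K) on the edge e: the trace operator is the
   closure, from H^1(K) to L^2(e), of the restriction to e of functions that
   are smooth up to the boundary of K. *)
Definition is_trace K e v (t : R * R -> R) : Prop :=
  [/\ inH1 (elt K) v, inL2e e t &
    exists w : nat -> R * R -> R,
      [/\ forall n, smooth (w n),
          normL2 (elt K) (fun x => w n x - v x) @[n --> \oo] --> 0,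
          normL2 (elt K) (fun x =>
              enorm ((partial false (w n) x, partial true (w n) x)
                     - grad (elt K) v x))
            @[n --> \oo] --> 0
        & normL2e e (fun x => w n x - t x) @[n --> \oo] --> 0]].

Definition edges_of K : {set {set V}} :=
  [set e : {set V} | (e \subset K) && (#|e| == 2)].

Variable T : {set {set V}}.

Definition edges : {set {set V}} := \bigcup_(K in T) edges_of K.

Definition elts_at e : {set {set V}} := [set K in T | e \in edges_of K].

Definition elt_patch K : {set {set V}} :=
  [set K' in T | [exists e in edges_of K, e \in edges_of K']].

Definition conforming_triangulation (Omega : set (R * R)) : Prop :=
  [/\ forall K, K \in T -> #|K| = 3 /\ elt K !=set0,
      closure Omega = \bigcup_(K in [set` T]) hull K
    & forall K K', K \in T -> K' \in T ->
        hull K `&` hull K' = hull (K :&: K')].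

Definition shape_regular (kappa : R) : Prop :=
  forall K, K \in T -> diam (hull K) <= kappa * indiam (hull K).

Section EdgeClasses.
Variables Omega GammaD GammaN : set (R * R).

Definition edges_bd : {set {set V}} :=
  [set e in edges | `[< hull e `<=` frontier Omega >]].
Definition edges_I : {set {set V}} := edges :\: edges_bd.
Definition edges_D : {set {set V}} :=
  [set e in edges_bd | `[< hull e `<=` closure GammaD >]].
Definition edges_N : {set {set V}} :=
  [set e in edges_bd | `[< hull e `<=` closure GammaN >]].

End EdgeClasses.

Definition inH1_broken (Omega : set (R * R)) v : Prop :=
  inL2 Omega v /\ forall K, K \in T -> inH1 (elt K) v.

(* |||v|||_omega, for a set omega of elements. *)
Definition energy (alpha : R * R -> R) (omega : {set {set V}}) v : R :=
  Num.sqrt (\sum_(K in omega)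
    normL2 (elt K) (fun x => Num.sqrt (alpha x) * enorm (grad (elt K) v x))
      ^+ 2).

Definition affine_on (D : set (R * R)) f : Prop :=
  exists a b c : R, forall x, D x -> f x = a * x.1 + b * x.2 + c.

(* f takes the value c at the midpoint of e, as the limit from each element
   having e as an edge; f itself is only meaningful inside the elements. *)
Definition value_at_mid f e (c : R) : Prop :=
  forall K, K \in elts_at e ->
    f x @[x --> within (elt K) (nbhs (midpt e))] --> c.

Definition crouzeix_raviart (Omega : set (R * R)) f : Prop :=
  [/\ inL2 Omega f, forall K, K \in T -> affine_on (elt K) f
    & forall e, e \in edges_I Omega -> exists c, value_at_mid f e c].

Definition nodal_basis (Omega : set (R * R)) (phi : {set V} -> R * R -> R)
    : Prop :=
  forall e, e \in edges -> crouzeix_raviart Omega (phi e) /\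
    forall e', e' \in edges -> value_at_mid (phi e) e' (e' == e)%:R.

Section Interpolation.
Variable Kp : {set V} -> {set V}.

Definition pi_edge v e : R := mean (elt (Kp e)) v.

Definition interp (phi : {set V} -> R * R -> R) v : R * R -> R :=
  fun x => \sum_(e in edges) pi_edge v e * phi e x.

End Interpolation.

(* Kp e and Km e are K_e^+ and K_e^-; on boundary edges both are K_e, so that
   alpha_e^+ and alpha_e^- are both the coefficient of K_e. *)
Definition edge_labelling (Omega : set (R * R)) (alphaK : {set V} -> R)
    (Kp Km : {set V} -> {set V}) : Prop :=
  (forall e, e \in edges_I Omega ->
     [/\ elts_at e = [set Kp e; Km e]%SET, Kp e != Km e
       & alphaK (Km e) <= alphaK (Kp e)]) /\
  (forall e, e \in edges_bd Omega ->
     elts_at e = [set Kp e]%SET /\ Km e = Kp e).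

Definition jump (Omega GammaD : set (R * R)) (Kp Km : {set V} -> {set V})
    (gD : R * R -> R) (tr : {set V} -> {set V} -> R * R -> R) e
    : R * R -> R :=
  fun x => if e \in edges_I Omega then tr (Kp e) e x - tr (Km e) e x
           else if e \in edges_D Omega GammaD then tr (Kp e) e x - gD x
           else 0.

End Mesh.

(* GammaD and GammaN are relatively open in the boundary of Omega. *)
Definition boundary_split (R : realType) (Omega GammaD GammaN : set (R * R))
    : Prop :=
  [/\ exists2 U, open U & GammaD = U `&` frontier Omega,
      exists2 U, open U & GammaN = U `&` frontier Omega,
      GammaD `&` GammaN = set0
    & frontier Omega = closure GammaD `|` closure GammaN].

Definition polygonal_partition (R : realType) (n : nat)
    (Omega : set (R * R)) (P : 'I_n -> set (R * R)) : Prop :=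
  [/\ forall i, polygonal_domain (P i) /\ P i `<=` Omega,
      forall i j, i != j -> P i `&` P j = set0
    & closure Omega = \bigcup_(i in setT) closure (P i)].

Definition piecewise_constant (R : realType) (n : nat)
    (Omega : set (R * R)) (P : 'I_n -> set (R * R)) (alpha : R * R -> R)
    : Prop :=
  (forall x, Omega x -> 0 < alpha x) /\
  (forall i, exists a : R, forall x, P i x -> alpha x = a).

(* Main.v *)
Require Import Defs.
From HB Require Import structures.
From mathcomp Require Import all_boot all_order all_algebra.
From mathcomp Require Import all_classical all_reals all_analysis.
From mathcomp Require Import measurable_realfun.
From mathcomp Require Import ring lra.

(* Everything is reduced to functions smooth up to the boundary, since the
   traces come with smooth approximations converging in H^1(K) and in L^2(e).
   Let F map the reference triangle {s, t > 0, s + t < 1} affinely onto K.  For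
   u = w o F and two points (s, t), (s', t') of the reference triangle, one of
   the broken lines through (s, t') and (s', t) stays inside, so
   |u(s,t) - u(s',t')|^2 is bounded by integrals of |grad u|^2 over full
   horizontal and vertical sections.  Integrating gives the Poincare inequality
   on K with a constant independent of its shape.  Averaging
   |u(s,0) - c|^2 <= 2 |u(s,0) - u(s,t)|^2 + 2 |u(s,t) - c|^2 over t < 1/2 gives
   the trace inequality, where shape regularity enters through h_K^2 <= C |K|.
   On K the basis functions of its edges sum to 1, so
   v - I_h v = (v - v_K) + sum_e (v_K - pi_e v) phi_e.  When pi_e v is the mean
   over the neighbour across e, the difference of the two means is bounded on e
   by both trace errors and the jump.  As K_e^+ carries the larger coefficient,
   only alpha_K = alpha_e^- appears in the bound. *)

Set Implicit Arguments.
Unset Strict Implicit.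
Unset Printing Implicit Defensive.

Import Order.TTheory GRing.Theory Num.Theory.
Import numFieldNormedType.Exports.

Local Open Scope classical_set_scope.
Local Open Scope ring_scope.

(** * The L^2 norm of a measure *)

Section L2.
Context d (T : measurableType d) (R : realType).
Variables (m : {measure set T -> \bar R}) (D : set T).
Hypothesis mD : measurable D.
Implicit Types f g : T -> R.

(** The sections of the reference triangle are taken in full because their integrals then depend on
    one coordinate only: the bound for a pair of points splits into a function of each point, and no
    path depending on both is left to integrate. In the Poincare inequality the Jacobian of the
    affine map occurs on both sides and cancels. An edge integral is not rescaled by it, so the
    trace inequality keeps a factor 1/|det|.

    Edges are measured through their parametrization on [0, 1]. There (alpha / h_e)^(1/2) times the
    norm of the jump on e is alpha^(1/2) times a parameter norm, so h_e is never compared with h_K.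

    An edge with K = K_e^+, in particular every boundary edge, contributes nothing to the difference
    of means, since pi_e v is then v_K itself. The Dirichlet datum thus enters only through a
    nonnegative term on the right. *)

Definition L2 f : Prop :=
  measurable_fun D f /\ m.-integrable D (fun x => (f x ^+ 2)%:E).

(** The measure is arbitrary so that the same lemmas serve area on an element and length on the
    parameter interval of an edge. *)
Definition nrm f : R := Num.sqrt (\int[m]_(x in D) (f x ^+ 2)).

Lemma measurable_sqr f : measurable_fun D f ->
  measurable_fun D (fun x => (f x ^+ 2)%:E).
Proof. by move=> mf; apply/measurable_EFinP; exact: measurable_funX. Qed.

Lemma L2_integral f : L2 f ->
  (\int[m]_(x in D) (f x ^+ 2)%:E = (\int[m]_(x in D) (f x ^+ 2))%:E)%E.
Proof. by move=> [_ h]; rewrite fineK//; exact: integrable_fin_num. Qed.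

Lemma nrm_ge0 f : 0 <= nrm f. Proof. exact: sqrtr_ge0. Qed.

Lemma nrm_sqr f : nrm f ^+ 2 = \int[m]_(x in D) (f x ^+ 2).
Proof. by rewrite sqr_sqrtr//; apply: Rintegral_ge0 => x _; exact: sqr_ge0. Qed.

Lemma nrm_sqrE f : L2 f ->
  ((nrm f ^+ 2)%:E = \int[m]_(x in D) (f x ^+ 2)%:E)%E.
Proof. by move=> lf; rewrite nrm_sqr L2_integral. Qed.

Lemma L2_le f g : measurable_fun D f -> L2 g ->
  (forall x, D x -> f x ^+ 2 <= g x ^+ 2) -> L2 f.
Proof.
move=> mf [mg ig] fg; split=> //; apply: le_integrable ig => //.
  exact: measurable_sqr.
by move=> x Dx /=; rewrite lee_fin !ger0_norm ?sqr_ge0//; exact: fg.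
Qed.

Lemma nrm_le f g : L2 f -> L2 g ->
  (forall x, D x -> f x ^+ 2 <= g x ^+ 2) -> nrm f <= nrm g.
Proof.
move=> [mf if_] [mg ig] fg; apply: ler_wsqrtr; exact: le_Rintegral.
Qed.

Lemma L2Z (k : R) f : L2 f -> L2 (fun x => k * f x).
Proof.
move=> [mf if_]; split; first exact: measurable_funM.
apply: (eq_integrable mD (fun x => ((k ^+ 2)%:E * (f x ^+ 2)%:E)%E)).
  by move=> x _; rewrite -EFinM exprMn.
exact: integrableZl.
Qed.

Lemma nrmZ (k : R) f : L2 f -> nrm (fun x => k * f x) = `|k| * nrm f.
Proof.
move=> [mf if_]; rewrite /nrm -sqrtr_sqr -sqrtrM ?sqr_ge0// -RintegralZl//.
by congr Num.sqrt; apply: eq_Rintegral => x _; rewrite exprMn.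
Qed.

Lemma L2D f g : L2 f -> L2 g -> L2 (fun x => f x + g x).
Proof.
move=> [mf if_] [mg ig]; split; first exact: measurable_funD.
have i2 : m.-integrable D
    (fun x => (2%:E * (f x ^+ 2)%:E + 2%:E * (g x ^+ 2)%:E)%E).
  by apply: (integrableD mD); exact: (integrableZl mD).
apply: le_integrable i2 => //.
  by apply: measurable_sqr; exact: measurable_funD.
move=> x _ /=; rewrite lee_fin (ger0_norm (sqr_ge0 _)).
apply: le_trans (ler_norm _).
rewrite -subr_ge0 (_ : _ - _ = (f x - g x) ^+ 2) ?sqr_ge0//; ring.
Qed.

Lemma L2B f g : L2 f -> L2 g -> L2 (fun x => f x - g x).
Proof.
move=> lf /(L2Z (-1)) lg; have := L2D lf lg; congr L2.
by apply/funext => x; rewrite mulN1r.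
Qed.

Lemma L2_sqrt_sum f g : L2 f -> L2 g ->
  L2 (fun x => Num.sqrt (f x ^+ 2 + g x ^+ 2)).
Proof.
move=> [mf if_] [mg ig]; split.
  apply: (measurableT_comp (f := @Num.sqrt R)).
    by apply: continuous_measurable_fun; exact: sqrt_continuous.
  by apply: measurable_funD; exact: measurable_funX.
apply: eq_integrable (integrableD mD if_ ig) => //.
by move=> x _ /=; rewrite sqr_sqrtr// addr_ge0 ?sqr_ge0.
Qed.

(** Minkowski from Young's inequality [(f + g)^2 <= (1 + b/a) f^2 + (1 + a/b) g^2]. With [a] and [b]
    above the two norms the right side integrates to at most [(a + b)^2]. The slack [e] keeps [a]
    and [b] positive even if a norm vanishes. *)
Lemma nrmD f g : L2 f -> L2 g -> nrm (fun x => f x + g x) <= nrm f + nrm g.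
Proof.
move=> lf lg; apply/ler_addgt0Pr => e e0.
pose a := nrm f + e / 2; pose b := nrm g + e / 2.
have a0 : 0 < a by rewrite ltr_wpDl ?nrm_ge0// divr_gt0.
have b0 : 0 < b by rewrite ltr_wpDl ?nrm_ge0// divr_gt0.
rewrite (_ : nrm f + nrm g + e = a + b); last by rewrite /a /b; lra.
rewrite -ler_sqr ?nnegrE ?nrm_ge0 ?(ltW (addr_gt0 a0 b0))//.
have [mf if_] := lf; have [mg ig] := lg.
have [_ ifg] := L2D lf lg.
have fa : \int[m]_(x in D) (f x ^+ 2) <= a ^+ 2.
  rewrite -nrm_sqr lerXn2r ?nnegrE ?nrm_ge0 ?(ltW a0)// /a lerDl.
  by rewrite divr_ge0// (ltW e0).
have gb : \int[m]_(x in D) (g x ^+ 2) <= b ^+ 2.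
  rewrite -nrm_sqr lerXn2r ?nnegrE ?nrm_ge0 ?(ltW b0)// /b lerDl.
  by rewrite divr_ge0// (ltW e0).
have ik k (h : T -> R) : m.-integrable D (fun x => (h x ^+ 2)%:E) ->
    m.-integrable D (EFin \o (fun x => k * h x ^+ 2)).
  by move=> ih; exact: (integrableZl mD k ih).
apply: (@le_trans _ _ (\int[m]_(x in D)
    ((1 + b / a) * f x ^+ 2 + (1 + a / b) * g x ^+ 2))).
  rewrite nrm_sqr; apply: le_Rintegral => //.
    exact: (integrableD mD (ik (1 + b / a) f if_) (ik (1 + a / b) g ig)).
  move=> x _; rewrite -subr_ge0.
  rewrite (_ : _ - _ = (b * f x - a * g x) ^+ 2 / (a * b)); last first.
    by field; rewrite !gt_eqF.
  by rewrite divr_ge0 ?sqr_ge0// mulr_ge0 ?(ltW a0) ?(ltW b0).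
rewrite RintegralD//; [|exact: ik|exact: ik].
rewrite !RintegralZl//.
apply: (@le_trans _ _ ((1 + b / a) * a ^+ 2 + (1 + a / b) * b ^+ 2)).
  by apply: lerD; rewrite ler_wpM2l// addr_ge0// divr_ge0 ?(ltW a0) ?(ltW b0).
by rewrite le_eqVlt; apply/orP; left; apply/eqP; field; rewrite !gt_eqF.
Qed.

Lemma nrm_distC f g : nrm (fun x => f x - g x) = nrm (fun x => g x - f x).
Proof.
by congr Num.sqrt; apply: eq_Rintegral => x _; rewrite -sqrrN opprB.
Qed.

Lemma nrmB_le f g h : L2 f -> L2 g -> L2 h ->
  nrm (fun x => f x - h x) <= nrm (fun x => f x - g x) + nrm (fun x =>
    g x - h x).
Proof.
move=> lf lg lh; have := nrmD (L2B lf lg) (L2B lg lh).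
by congr (nrm _ <= _); apply/funext => x; ring.
Qed.

Lemma nrm_sum (I : finType) (P : pred I) (F : I -> T -> R) :
  (forall i, P i -> L2 (F i)) -> L2 (fun=> 0) ->
  L2 (fun x => \sum_(i | P i) F i x) /\
  nrm (fun x => \sum_(i | P i) F i x) <= \sum_(i | P i) nrm (F i).
Proof.
move=> lF l0.
have n0 : nrm (fun=> 0) = 0.
  rewrite /nrm; under eq_Rintegral do rewrite expr0n/=.
  by rewrite /Rintegral integral0 sqrtr0.
have -> : (fun x => \sum_(i | P i) F i x) = \sum_(i | P i) F i.
  by apply/funext => x; rewrite fct_sumE.
apply: (big_rec2 (fun f r => L2 f /\ nrm f <= r)); first by rewrite n0.
move=> i r f Pi [lf fr]; have lFi := lF i Pi; split; first exact: L2D.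
by apply: le_trans (nrmD lFi lf) _; rewrite lerD2l.
Qed.

Section Finite.
Hypothesis finD : m D \is a fin_num.

Lemma L2_cst (k : R) : L2 (fun=> k).
Proof.
split; first exact: measurable_cst.
apply: (@measurable_bounded_integrable _ _ _ m (fun=> k ^+ 2)) => //.
  by rewrite -ge0_fin_numE.
exists (k ^+ 2); split=> [|M kM x _ /=]; first exact: num_real.
by rewrite ger0_norm ?sqr_ge0// ltW.
Qed.

(** On a set of finite measure [|f| <= 1 + f^2] suffices. *)
Lemma L2_integrable f : L2 f -> m.-integrable D (EFin \o f).
Proof.
move=> [mf if_].
have i1 : m.-integrable D (fun x => ((1 ^+ 2)%:E + (f x ^+ 2)%:E)%E).
  by apply: (integrableD mD) => //; have [] := L2_cst 1.
apply: le_integrable i1 => //; first exact/measurable_EFinP.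
move=> x _ /=; rewrite lee_fin; apply: le_trans (ler_norm _).
rewrite -subr_ge0 -(real_normK (num_real (f x))).
rewrite (_ : _ - _ = (`|f x| - 2^-1) ^+ 2 + 3 / 4); last by field.
by rewrite addr_ge0 ?sqr_ge0// divr_ge0.
Qed.

Lemma nrm_cst (k : R) : nrm (fun=> k) = `|k| * Num.sqrt (fine (m D)).
Proof. by rewrite /nrm Rintegral_cst// sqrtrM ?sqr_ge0// sqrtr_sqr. Qed.

Hypothesis D_gt0 : 0 < fine (m D).

(* Integrating [2 d (c - f) - d ^ 2 <= (c - f) ^ 2] with [d = c - average f]. *)
Lemma jensen_average f (c : R) : L2 f ->
  fine (m D) * (c - (\int[m]_(x in D) f x) / fine (m D)) ^+ 2 <=
  \int[m]_(x in D) ((c - f x) ^+ 2).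
Proof.
move=> lf; set a := _ / _; pose d' := c - a.
have ae : \int[m]_(x in D) f x = a * fine (m D) by rewrite divfK// gt_eqF.
have ck k : m.-integrable D (EFin \o (fun=> k)) := L2_integrable (L2_cst k).
have if2 : m.-integrable D (EFin \o (fun x => 2 * d' * f x)).
  exact: L2_integrable (L2Z _ lf).
have ig : m.-integrable D
    (EFin \o (fun x => (2 * d' * c - d' ^+ 2) - 2 * d' * f x)).
  exact: (integrableB mD (ck _) if2).
have [_ icf] := L2B (L2_cst c) lf.
apply: le_trans (le_Rintegral mD ig icf _).
  rewrite RintegralB// RintegralZl//; last exact: L2_integrable.
  rewrite ae Rintegral_cst//.
  by rewrite le_eqVlt; apply/orP; left; apply/eqP; rewrite /d'; ring.
move=> x _; rewrite -subr_ge0 (_ : _ - _ = (d' - (c - f x)) ^+ 2) ?sqr_ge0//.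
ring.
Qed.

(** Replacing the average by any other constant costs a factor 2. This spares the passage to the
    limit in the means of the smooth approximations. *)
Lemma nrm_average f (c : R) : L2 f ->
  nrm (fun x => f x - (\int[m]_(y in D) f y) / fine (m D)) <=
  2 * nrm (fun x => f x - c).
Proof.
move=> lf; set a := _ / _.
apply: le_trans (nrmB_le lf (L2_cst c) (L2_cst a)) _.
rewrite mulr_natl mulr2n lerD2l nrm_cst (nrm_distC f).
rewrite -(sqrtr_sqr (c - a)) -sqrtrM ?sqr_ge0// mulrC; apply: ler_wsqrtr.
exact: jensen_average.
Qed.

End Finite.
End L2.

(** * Affine change of variables in the plane *)

Section PlaneMeasure.
Variable R : realType.
Notation mu := (@lebesgue_measure R).
Notation leb2 := (@leb2 R).

Lemma tonelli1 (f : R * R -> \bar R) :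
  measurable_fun [set: R * R] f -> (forall x, 0 <= f x)%E ->
  (\int[leb2]_x f x = \int[mu]_x \int[mu]_y f (x, y))%E.
Proof. move=> mf f0; exact: (fubini_tonelli1 (m1:=mu) (m2:=mu) f mf f0). Qed.

Lemma tonelli2 (f : R * R -> \bar R) :
  measurable_fun [set: R * R] f -> (forall x, 0 <= f x)%E ->
  (\int[leb2]_x f x = \int[mu]_y \int[mu]_x f (x, y))%E.
Proof. move=> mf f0; exact: (fubini_tonelli2 (m1:=mu) (m2:=mu) f mf f0). Qed.

Lemma tonelli_mF (f : R * R -> \bar R) :
  measurable_fun [set: R * R] f -> (forall x, 0 <= f x)%E ->
  measurable_fun [set: R] (fun x => \int[mu]_y f (x, y))%E.
Proof.
by move=> mf f0; exact: (measurable_fun_fubini_tonelli_F (m2:=mu) f mf f0).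
Qed.

Lemma tonelli_mG (f : R * R -> \bar R) :
  measurable_fun [set: R * R] f -> (forall x, 0 <= f x)%E ->
  measurable_fun [set: R] (fun y => \int[mu]_x f (x, y))%E.
Proof.
by move=> mf f0; exact: (measurable_fun_fubini_tonelli_G (m1:=mu) f mf f0).
Qed.

(** The sigma-algebra of the plane is the product one, whereas openness is topological; countably
    many boxes with rational corners link the two. *)
Lemma open_measurable2 (U : set (R * R)) : open U -> measurable U.
Proof.
move=> oU.
pose box (q : rat * rat * (rat * rat)) : set (R * R) :=
  `]ratr q.1.1, ratr q.1.2[%classic `*` `]ratr q.2.1, ratr q.2.2[%classic.
rewrite (_ : U = \bigcup_(q in [set q | box q `<=` U]) box q); last first.
  apply/seteqP; split => [x Ux|x [q /= qU]]; last exact: qU.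
  have /nbhs_ballP[e /= e0 eU] : nbhs x U by exact: open_nbhs_nbhs.
  have rat_near (z : R) : exists q : rat * rat,
      [/\ z - e < ratr q.1, ratr q.1 < z, z < ratr q.2 & ratr q.2 < z + e].
    have [q1] := @rat_in_itvoo R (z - e) z ltac:(by rewrite ltrBlDr ltrDl).
    have [q2] := @rat_in_itvoo R z (z + e) ltac:(by rewrite ltrDl).
    by rewrite !in_itv/= => /andP[? ?] /andP[? ?]; exists (q1, q2).
  have [p [p1 p2 p3 p4]] := rat_near x.1.
  have [q [q1 q2 q3 q4]] := rat_near x.2.
  exists (p, q); rewrite /box/=; last first.
    by split; rewrite /= in_itv /= ?p2 ?q2.
  move=> y [/=]; rewrite !in_itv /= => /andP[h1 h2] /andP[h3 h4].
  apply: eU; split; rewrite /ball /= ltr_norml; apply/andP; split; lra.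
rewrite bigcup_mkcond; apply: countable_bigcupT_measurable => // q.
case: ifP => _; last exact: measurable0.
by apply: measurableX; exact: measurable_itv.
Qed.

Lemma continuous_measurable2 (f : R * R -> R) :
  continuous f -> measurable_fun [set: R * R] f.
Proof.
move=> cf; apply: (measurability _ (RGenOpens.measurableE R)).
move=> _ [_ [a [b ->] <-]]; rewrite setTI; apply: open_measurable2.
by apply: open_comp => // x _; exact: cf.
Qed.

(** The pushforward of Lebesgue measure under the affine map, scaled by [|b|], gives half-open
    intervals their length, hence is Lebesgue measure. For negative [b] the preimage is closed on
    the other side. *)
Lemma integral_affine (a b : R) (f : R -> \bar R) : b != 0 ->
  measurable_fun [set: R] f -> (forall x, 0 <= f x)%E ->
  (\int[mu]_x f x = `|b|%:E * \int[mu]_x f (a + b * x)%R)%E.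
Proof.
move=> b0 mf f0.
pose h (x : measurableTypeR R) : measurableTypeR R := a + b * x.
have mh : measurable_fun setT h.
  by apply: measurable_funD => //; exact: measurable_funM.
have nb : 0 <= `|b| by [].
pose m0 : {measure set (measurableTypeR R) -> \bar R} :=
  mscale (NngNum nb) (pushforward mu h).
pose m := m0 mh.
have -> : (`|b|%:E * \int[mu]_x f (a + b * x)%R = \int[m]_x f x)%E.
  rewrite ge0_integral_mscale//.
  by rewrite ge0_integral_pushforward.
apply: eq_measure_integral => A mA _.
apply: lebesgue_measure_unique => // _ [[c d] _ <-] /=.
rewrite /m /m0 /mscale /= /pushforward /h.
have itvE : [set x | h x \in `]c, d] ] = if 0 < b then
    `]((c - a) / b), ((d - a) / b)]%classic
    else `[((d - a) / b), ((c - a) / b)[%classic :> set R.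
  apply/seteqP; split => x; case: ltP => b0'; rewrite /= !in_itv /= /h.
  - by rewrite ltr_pdivrMr// ler_pdivlMr// => /andP[? ?]; apply/andP; split;
    lra.
  - have {}b0' : b < 0 by rewrite lt_neqAle b0.
    rewrite ler_ndivrMr// ltr_ndivlMr// => /andP[? ?]; apply/andP; split; lra.
  - by rewrite ltr_pdivrMr// ler_pdivlMr// => /andP[? ?]; apply/andP; split;
    lra.
  - have {}b0' : b < 0 by rewrite lt_neqAle b0.
    rewrite ler_ndivrMr// ltr_ndivlMr// => /andP[? ?]; apply/andP; split; lra.
transitivity (`|b|%:E * mu [set x | h x \in `]c, d] ])%E; last by [].
rewrite itvE; case: ltP => b0'; rewrite !lebesgue_measure_itv /= !lte_fin.
  rewrite ltr_pM2r ?invr_gt0// ltrD2r; case: ifP => _; last by rewrite mule0.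
  by rewrite -!EFinB -?EFinM gtr0_norm//; congr (_%:E); field.
have {}b0' : b < 0 by rewrite lt_neqAle b0.
rewrite ltr_nM2r ?invr_lt0// ltrD2r; case: ifP => _; last by rewrite mule0.
by rewrite -!EFinB -?EFinM ltr0_norm//; congr (_%:E); field.
Qed.

Lemma measurable_aff2 (a b c : R) :
  measurable_fun [set: R * R] (fun p : R * R => a + p.1 * b + p.2 * c).
Proof.
have m1 := measurable_fst; have m2 := measurable_snd.
apply: measurable_funD; last exact: measurable_funM.
by apply: measurable_funD => //; exact: measurable_funM.
Qed.

Lemma measurable_comp_aff2 (f : R * R -> \bar R) (a1 b1 c1 a2 b2 c2 : R) :
  measurable_fun [set: R * R] f ->
  measurable_fun [set: R * R] (fun p : R * R =>
    f (a1 + p.1 * b1 + p.2 * c1, a2 + p.1 * b2 + p.2 * c2)).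
Proof.
move=> mf; apply: (measurableT_comp mf).
by apply/measurable_fun_pairP; split; exact: measurable_aff2.
Qed.

Lemma integral_swap (f : R * R -> \bar R) :
  measurable_fun [set: R * R] f -> (forall x, 0 <= f x)%E ->
  (\int[leb2]_p f (p.2, p.1) = \int[leb2]_p f p)%E.
Proof.
move=> mf f0; rewrite [RHS]tonelli2// tonelli1//.
rewrite (_ : (fun p => _) = (fun p : R * R =>
  f (0 + p.1 * 0 + p.2 * 1, 0 + p.1 * 1 + p.2 * 0))); last first.
  by apply/funext => p; congr (f (_, _)); ring.
exact: measurable_comp_aff2.
Qed.

Lemma integral_affine2 (f : R * R -> \bar R) (a1 b1 c1 a2 b2 c2 : R) :
  b1 * c2 - b2 * c1 != 0 ->
  measurable_fun [set: R * R] f -> (forall x, 0 <= f x)%E ->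
  (\int[leb2]_x f x = `|b1 * c2 - b2 * c1|%:E *
    \int[leb2]_p f (a1 + p.1 * b1 + p.2 * c1, a2 + p.1 * b2 + p.2 * c2)%R)%E.
Proof.
move=> d0 mf f0.
(* If [c1] vanishes then [b1] does not, and exchanging the two parameters exchanges the columns of
   the matrix. *)
wlog c10 : b1 b2 c1 c2 d0 / c1 != 0 => [hw|].
  have [c1E|] := eqVneq c1 0; last exact: hw.
  have b10 : b1 != 0.
    by apply: contra_neq d0 => ->; rewrite c1E; ring.
  rewrite (hw c1 c2 b1 b2)//;
    last by rewrite -opprB oppr_eq0 (mulrC c1) (mulrC c2).
  rewrite distrC (mulrC c1) (mulrC c2); congr (_ * _)%E.
  rewrite -integral_swap//=; last exact: measurable_comp_aff2.
  by apply: eq_integral => p _; congr (f (_, _)); ring.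
(* Two substitutions in one variable: for fixed [x] the ordinate is affine in [s] with slope [k];
   after exchanging the integrals, for fixed [s] the abscissa is affine in [t] with slope [c1]. The
   Jacobian is [|k| |c1|]. *)
pose k := (b2 * c1 - b1 * c2) / c1.
have k0 : k != 0 by rewrite mulf_neq0 ?invr_neq0// -opprB oppr_eq0.
pose g (p : R * R) := f (p.1, a2 + c2 / c1 * (p.1 - a1) + k * p.2).
have mg : measurable_fun [set: R * R] g.
  rewrite (_ : g = (fun p : R * R => f (0 + p.1 * 1 + p.2 * 0,
    (a2 - c2 / c1 * a1) + p.1 * (c2 / c1) + p.2 * k))); last first.
    by apply/funext => p; rewrite /g; congr (f (_, _)); ring.
  exact: measurable_comp_aff2.
have mfx x : measurable_fun [set: R] (fun y => f (x, y)).
  exact: measurableT_comp mf (measurable_pair1 x).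
have mgy y : measurable_fun [set: R] (fun x => g (x, y)).
  exact: measurableT_comp mg (measurable_pair2 y).
rewrite tonelli1//.
transitivity (\int[mu]_x (`|k|%:E * \int[mu]_s g (x, s)))%E.
  by apply: eq_integral => x _;
    rewrite (integral_affine (a2 + c2 / c1 * (x - a1)) k0 (mfx x)).
rewrite /= ge0_integralZl//; last 2 first.
- by apply: (tonelli_mF mg) => ?; exact: f0.
- by move=> x _; apply: integral_ge0 => ? _; exact: f0.
rewrite -(tonelli1 mg) ?(tonelli2 mg); try by move=> ?; exact: f0.
transitivity (`|k|%:E *
    \int[mu]_s (`|c1|%:E * \int[mu]_t g ((a1 + s * b1) + c1 * t, s)%R))%E.
  by congr (_ * _)%E; apply: eq_integral => s _;
    rewrite (integral_affine (a1 + s * b1) c10 (mgy s)) => // x; exact: f0.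
rewrite /= ge0_integralZl//; last 2 first.
- apply: (@tonelli_mF (fun p => g (a1 + p.1 * b1 + c1 * p.2, p.1)));
    last by move=> ?; exact: f0.
  rewrite (_ : (fun p => _) = (fun p : R * R =>
    g (a1 + p.1 * b1 + p.2 * c1, 0 + p.1 * 1 + p.2 * 0))); last first.
    by apply/funext => p; congr (g (_, _)); ring.
  exact: measurable_comp_aff2.
- by move=> x _; apply: integral_ge0 => ? _; exact: f0.
rewrite muleA -EFinM -normrM tonelli1//; last exact: measurable_comp_aff2.
congr (_%:E * _)%E; first by rewrite -normrN; congr `| _ |; rewrite /k; field.
apply: eq_integral => s _; apply: eq_integral => t _; rewrite /g /=.
by congr (f (_, _)); rewrite /k; field.
Qed.
End PlaneMeasure.

(** * Estimates on the reference triangle *)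

Section ReferenceTriangle.
Variable R : realType.
Notation mu := (@lebesgue_measure R).
Notation leb2 := (@leb2 R).

(** With [D] the increment, integrating [2 D f' - D^2 <= f'^2] gives [2 D^2 - D^2 (b - a)], which is
    at least [D^2] on an interval of length at most 1. The open interval allows an endpoint on the
    boundary of the triangle. *)
Lemma sqr_increment (f df : R -> R) (a b : R) : a <= b -> b - a <= 1 ->
  (forall x : R, is_derive x 1 f (df x)) -> continuous df ->
  (((f b - f a) ^+ 2)%:E <= \int[mu]_(x in `]a, b[) (df x ^+ 2)%:E)%E.
Proof.
move=> ab ba1 hf cdf.
have [->|aNb] := eqVneq a b.
  by rewrite subrr expr0n/= integral_ge0// => x _; rewrite lee_fin sqr_ge0.
have {aNb}ltab : a < b by rewrite lt_neqAle aNb.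
pose D := f b - f a.
pose F x := 2 * D * f x - D ^+ 2 * x.
pose dF x := 2 * D * df x - D ^+ 2.
have hF (x : R) : is_derive x 1 F (dF x).
  rewrite /F /dF; have h := hf x; apply: is_derive_eq.
  by rewrite /GRing.scale /= !(mulr1, mulr0, addr0, add0r).
have cF : continuous F.
  by move=> x; apply: differentiable_continuous; apply/derivable1_diffP;
     have [] := hF x.
have cdF : continuous dF.
  move=> x; apply: cvgB; last exact: cvg_cst.
  by apply: cvgM; [exact: cvg_cst|exact: cdf].
have cdf2 : continuous (fun x => df x ^+ 2).
  by move=> x; apply: (cvgM (cdf x) (cdf x)).
have mdf2 : measurable_fun [set: R] (fun x => (df x ^+ 2)%:E).
  by apply/measurable_EFinP; exact: continuous_measurable_fun.
rewrite -(integral_itv_bndoo true false); last exact: measurable_funTS.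
have itg (g : R -> R) : continuous g -> mu.-integrable `[a, b] (EFin \o g).
  move=> cg; apply: continuous_compact_integrable; first exact: segment_compact.
  exact: continuous_subspaceT.
apply: (@le_trans _ _ (\int[mu]_(x in `[a, b]) (dF x)%:E)%E); last first.
  apply: le_integral (itg _ cdF) (itg _ cdf2) _; first exact: measurable_itv.
  move=> x _; rewrite lee_fin /dF -subr_ge0.
  have -> : df x ^+ 2 - (2 * D * df x - D ^+ 2) = (df x - D) ^+ 2 by ring.
  exact: sqr_ge0.
rewrite (@continuous_FTC2 _ dF F)//.
- rewrite -EFinB lee_fin /F -/D.
    have -> : 2 * D * f b - D ^+ 2 * b - (2 * D * f a - D ^+ 2 * a) =
      D ^+ 2 + D ^+ 2 * (1 - (b - a)) by rewrite /D; ring.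
    by rewrite lerDl mulr_ge0 ?sqr_ge0// subr_ge0.
- exact: continuous_subspaceT.
- split; first by move=> x _; have [] := hF x.
      by apply: cvg_at_right_filter; exact: cF.
    by apply: cvg_at_left_filter; exact: cF.
- by move=> x _; rewrite derive1E; have h := hF x; rewrite derive_val.
Qed.

Definition tri : set (R * R) := [set p | [/\ 0 < p.1, 0 < p.2 & p.1 + p.2 < 1]].

Lemma cvg_comp_pair (S : Type) (F : set_system S) {FF : Filter F}
    (w : R * R -> R) (f g : S -> R) (a b : R) : continuous w ->
  f @ F --> a -> g @ F --> b -> w (f x, g x) @[x --> F] --> w (a, b).
Proof.
by move=> cw fa gb; exact: (cvg_comp _ w (cvg_pair fa gb) (cw (a, b))).
Qed.

Lemma open_gt0 (f : R * R -> R) : continuous f -> open [set p | 0 < f p].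
Proof.
move=> cf; rewrite (_ : [set p | 0 < f p] = f @^-1` [set x | 0 < x])//.
by apply: open_comp => [p _|]; [exact: cf|exact: open_gt].
Qed.

Lemma open_tri : open tri.
Proof.
have -> : tri = [set p | 0 < p.1] `&` [set p | 0 < p.2] `&`
    [set p | 0 < 1 - (p.1 + p.2)].
  by apply/seteqP; split => p /=; rewrite subr_gt0; [case|case=> -[]].
have c1 : continuous (fst : R * R -> R) by move=> p; exact: cvg_fst.
have c2 : continuous (snd : R * R -> R) by move=> p; exact: cvg_snd.
apply: openI; first by apply: openI; exact: open_gt0.
apply: open_gt0 => p; apply: cvgB; first exact: cvg_cst.
by apply: cvgD; [exact: c1|exact: c2].
Qed.

Lemma measurable_tri : measurable tri.
Proof. exact: open_measurable2 open_tri. Qed.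

(** Sections of [tri] have length at most 1. This turns a bound by section integrals back into an
    integral over the triangle. *)
Lemma tri_strip1 (f : R -> \bar R) :
  measurable_fun [set: R] f -> (forall x, 0 <= f x)%E ->
  (\int[leb2]_(p in tri) f p.1 <= \int[mu]_s f s)%E.
Proof.
move=> mf f0; rewrite integral_mkcond.
have mfp : measurable_fun [set: R * R] (fun p : R * R => f p.1).
  exact: measurableT_comp mf measurable_fst.
have mip : measurable_fun [set: R * R]
    (fun p : R * R => \1_(`]0%R, 1%R[%classic : set R) p.2 : R).
  by apply: measurableT_comp measurable_snd; exact: measurable_indic.
pose g (p : R * R) := (f p.1 * (\1_(`]0%R, 1%R[%classic : set R) p.2)%:E)%E.
have mg : measurable_fun [set: R * R] g.
  by apply: emeasurable_funM => //; exact/measurable_EFinP.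
have g0 p : (0 <= g p)%E by rewrite mule_ge0// lee_fin.
have mf1 : measurable_fun [set: R * R] ((f \o fst) \_ tri).
  apply: (measurable_restrictT _ measurable_tri).1.
  exact: measurable_funTS.
apply: (@le_trans _ _ (\int[leb2]_p g p)%E).
  apply: ge0_le_integral => //.
  - by move=> p _; rewrite patchE; case: ifP.
  - move=> p _; rewrite patchE; case: ifPn => [|_]; last exact: g0.
    rewrite inE => -[p1 p2 p3]; rewrite /g indicE mem_set ?mule1//.
    by rewrite /= in_itv/= p2/=; lra.
rewrite tonelli1// le_eqVlt; apply/orP; left; apply/eqP.
apply: eq_integral => s _; rewrite /g /=.
rewrite ge0_integralZl//; last first.
  by apply/measurable_EFinP; exact: measurable_indic.
rewrite integral_indic// setIT [X in (_ * X)%E](_ : _ = mu `]0%R, 1%R[)//.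
by rewrite lebesgue_measure_itv /= lte_fin ltr01 oppr0 adde0 mule1.
Qed.

Lemma tri_strip2 (f : R -> \bar R) :
  measurable_fun [set: R] f -> (forall x, 0 <= f x)%E ->
  (\int[leb2]_(p in tri) f p.2 <= \int[mu]_s f s)%E.
Proof.
move=> mf f0; apply: le_trans (tri_strip1 mf f0).
rewrite [leLHS]integral_mkcond [leRHS]integral_mkcond -integral_swap.
- rewrite le_eqVlt; apply/orP; left; apply/eqP.
  apply: eq_integral => p _; rewrite !patchE /=.
  congr (if _ then _ else _); apply/idP/idP; rewrite !inE /tri/=;
    by case=> *; split=> //; rewrite addrC.
- apply: (measurable_restrictT _ measurable_tri).1.
  by apply: measurable_funTS; exact: measurableT_comp mf measurable_snd.
- by move=> p; rewrite patchE; case: ifP.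
Qed.

Lemma leb2_tri_le1 : (leb2 tri <= 1)%E.
Proof.
pose f (x : R) := ((\1_(`]0%R, 1%R[%classic : set R) x : R)%:E).
have mf : measurable_fun [set: R] f.
  by apply/measurable_EFinP; exact: measurable_indic.
have f0 x : (0 <= f x)%E by rewrite lee_fin.
have -> : leb2 tri = (\int[leb2]_(p in tri) f p.1)%E.
  rewrite (eq_integral (cst 1%E)); last first.
    move=> p; rewrite inE => -[p1 p2 p3]; rewrite /f indicE mem_set//.
    by rewrite /= in_itv/= p1/=; lra.
  by rewrite integral_cst ?mul1e//; exact: measurable_tri.
apply: le_trans (tri_strip1 mf f0) _.
rewrite integral_indic// setIT [X in (X <= _)%E](_ : _ = mu `]0%R, 1%R[)//.
by rewrite lebesgue_measure_itv /= lte_fin ltr01 oppr0 adde0.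
Qed.

(** The area is 1/2; the inscribed square of side 1/2 gives a lower bound that is enough. *)
Lemma leb2_tri_ge : (4^-1%:E <= leb2 tri)%E.
Proof.
have mi : measurable (`]0%R, 2^-1%R[%classic : set R) by exact: measurable_itv.
have -> : (4^-1%:E = leb2 (`]0%R, 2^-1%R[%classic `*` `]0%R,
  2^-1%R[%classic))%E.
  rewrite /Defs.leb2 product_measure1E//.
  rewrite [X in (_ = X * X)%E](_ : _ = mu `]0%R, 2^-1%R[)//.
  rewrite !lebesgue_measure_itv /= lte_fin invr_gt0 ltr0n oppr0 adde0 -EFinM.
  by congr (_%:E); field.
apply: le_measure; rewrite ?inE; [exact: measurableX|exact: measurable_tri|].
move=> p [] /=; rewrite !in_itv/= => /andP[p1 p2] /andP[p3 p4].
by split=> //; lra.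
Qed.

Section C1.
Variables u us ut : R * R -> R.
Hypothesis cu : continuous u.
Hypothesis cus : continuous us.
Hypothesis cut : continuous ut.
Hypothesis hus : forall t s : R, is_derive s 1 (fun s => u (s, t)) (us (s, t)).
Hypothesis hut : forall s t : R, is_derive t 1 (fun t => u (s, t)) (ut (s, t)).

Let sq (w : R * R -> R) : R * R -> \bar R := (fun p => (w p ^+ 2)%:E) \_ tri.
(** [V] and [H] integrate over the whole vertical and horizontal section, so they dominate the
    increment between any two points of that section. Extended values avoid integrability conditions
    in Tonelli's theorem. *)
Let V s : \bar R := (\int[mu]_t sq ut (s, t))%E.
Let H t : \bar R := (\int[mu]_s sq us (s, t))%E.

Let sq_ge0 w p : (0 <= sq w p)%E.
Proof. by rewrite /sq patchE; case: ifP => // _; rewrite lee_fin sqr_ge0. Qed.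

Let measurable_sq (w : R * R -> R) : continuous w ->
  measurable_fun [set: R * R] (sq w).
Proof.
move=> cw; apply: (measurable_restrictT _ measurable_tri).1.
apply: measurable_funTS; apply/measurable_EFinP.
by apply: continuous_measurable2 => x; apply: (cvgM (cw x) (cw x)).
Qed.

Let mV : measurable_fun [set: R] V.
Proof. by apply: tonelli_mF; [exact: measurable_sq|exact: sq_ge0]. Qed.

Let mH : measurable_fun [set: R] H.
Proof. by apply: tonelli_mG; [exact: measurable_sq|exact: sq_ge0]. Qed.

Let V0 s : (0 <= V s)%E. Proof. by apply: integral_ge0 => t _. Qed.
Let H0 t : (0 <= H t)%E. Proof. by apply: integral_ge0 => s _. Qed.

Let integral_V : (\int[mu]_s V s = \int[leb2]_(p in tri) (ut p ^+ 2)%:E)%E.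
Proof.
by rewrite [RHS]integral_mkcond;
  exact: (esym (tonelli1 (measurable_sq cut) (sq_ge0 ut))).
Qed.

Let integral_H : (\int[mu]_t H t = \int[leb2]_(p in tri) (us p ^+ 2)%:E)%E.
Proof.
by rewrite [RHS]integral_mkcond;
  exact: (esym (tonelli2 (measurable_sq cus) (sq_ge0 us))).
Qed.

Let cont1 (w : R * R -> R) (t : R) : continuous w ->
  continuous (fun s : R => w (s, t) : R).
Proof.
by move=> cw s; apply: (cvg_comp_pair cw); [exact: cvg_id|exact: cvg_cst].
Qed.

Let cont2 (w : R * R -> R) (s : R) : continuous w ->
  continuous (fun t : R => w (s, t) : R).
Proof.
by move=> cw t; apply: (cvg_comp_pair cw); [exact: cvg_cst|exact: cvg_id].
Qed.

(** The value [t = 0] is allowed: the trace estimate starts from the edge. *)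
Let vert (s t t' : R) : 0 < s -> 0 <= t -> s + t < 1 -> 0 <= t' -> s + t' < 1 ->
  (((u (s, t) - u (s, t')) ^+ 2)%:E <= V s)%E.
Proof.
move=> s0; wlog tt' : t t' / t' <= t => [hw|].
  move=> t0 st t'0 st'; case/orP: (le_total t t') => ?; last exact: hw.
  by rewrite -sqrrN opprB; exact: hw.
move=> t0 st t'0 st'.
have t1 : t - t' <= 1 by lra.
apply: le_trans (sqr_increment tt' t1 (hut s) (@cont2 _ s cut)) _.
rewrite /V integral_mkcond; apply: ge0_le_integral => //.
- by move=> x _; rewrite patchE; case: ifP => // _; rewrite lee_fin sqr_ge0.
- apply: (measurable_restrictT _ _).1; first exact: measurable_itv.
  apply: measurable_funTS; apply/measurable_EFinP.
  apply: continuous_measurable_fun => x.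
  by apply: (cvgM (@cont2 _ s cut x) (@cont2 _ s cut x)).
- exact: measurableT_comp (measurable_sq cut) (measurable_pair1 s).
- move=> x _; rewrite patchE; case: ifPn => [|_]; last exact: sq_ge0.
  rewrite inE /= in_itv /= => /andP[x1 x2].
  by rewrite /sq patchE mem_set//; split => //=; lra.
Qed.

Let horiz (t s s' : R) : 0 < t -> 0 <= s -> s + t < 1 -> 0 <= s' ->
  s' + t < 1 ->
  (((u (s, t) - u (s', t)) ^+ 2)%:E <= H t)%E.
Proof.
move=> t0; wlog ss' : s s' / s' <= s => [hw|].
  move=> s0 st s'0 st'; case/orP: (le_total s s') => ?; last exact: hw.
  by rewrite -sqrrN opprB; exact: hw.
move=> s0 st s'0 st'.
have s1 : s - s' <= 1 by lra.
apply: le_trans (sqr_increment ss' s1 (hus t) (@cont1 _ t cus)) _.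
rewrite /H integral_mkcond; apply: ge0_le_integral => //.
- by move=> x _; rewrite patchE; case: ifP => // _; rewrite lee_fin sqr_ge0.
- apply: (measurable_restrictT _ _).1; first exact: measurable_itv.
  apply: measurable_funTS; apply/measurable_EFinP.
  apply: continuous_measurable_fun => x.
  by apply: (cvgM (@cont1 _ t cus x) (@cont1 _ t cus x)).
- exact: measurableT_comp (measurable_sq cus) (measurable_pair2 t).
- move=> x _; rewrite patchE; case: ifPn => [|_]; last exact: sq_ge0.
  rewrite inE /= in_itv /= => /andP[x1 x2].
  by rewrite /sq patchE mem_set//; split => //=; lra.
Qed.

Let E : \bar R := (\int[leb2]_(p in tri) (us p ^+ 2 + ut p ^+ 2)%:E)%E.
Let W (p : R * R) : \bar R := (V p.1 + H p.2)%E.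

Let E0 : (0 <= E)%E.
Proof. by apply: integral_ge0 => p _; rewrite lee_fin addr_ge0 ?sqr_ge0. Qed.

Let W0 p : (0 <= W p)%E. Proof. exact: adde_ge0. Qed.

Let mVp : measurable_fun [set: R * R] (fun p : R * R => V p.1).
Proof. exact: measurableT_comp mV measurable_fst. Qed.

Let mHp : measurable_fun [set: R * R] (fun p : R * R => H p.2).
Proof. exact: measurableT_comp mH measurable_snd. Qed.

Let mW : measurable_fun [set: R * R] W.
Proof. exact: emeasurable_funD. Qed.

Let msq2 (w : R * R -> R) : continuous w ->
  measurable_fun [set: R * R] (fun p : R * R => (w p ^+ 2)%:E).
Proof.
move=> cw; apply/measurable_EFinP.
by apply: continuous_measurable2 => x; apply: (cvgM (cw x) (cw x)).
Qed.

Let E_sum : (E = \int[leb2]_(p in tri) (ut p ^+ 2)%:E +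
                 \int[leb2]_(p in tri) (us p ^+ 2)%:E)%E.
Proof.
rewrite -ge0_integralD//; first last.
- by apply: measurable_funTS; exact: msq2.
- by move=> p _; rewrite lee_fin sqr_ge0.
- by apply: measurable_funTS; exact: msq2.
- by move=> p _; rewrite lee_fin sqr_ge0.
- exact: measurable_tri.
by apply: eq_integral => p _; rewrite -EFinD addrC.
Qed.

Let int_W : (\int[leb2]_(p in tri) W p <= E)%E.
Proof.
rewrite ge0_integralD//; first last.
- exact: measurable_funTS.
- exact: measurable_funTS.
- exact: measurable_tri.
rewrite E_sum -integral_V -integral_H.
by apply: leeD; [exact: tri_strip1|exact: tri_strip2].
Qed.

Let pointwise p q : tri p -> tri q ->
  (((u p - u q) ^+ 2)%:E <= 2%:E * (W p + W q))%E.
Proof.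
(* The four coordinates of [p] and [q] sum to less than 2, so one of the corners [(p.1, q.2)] and
   [(q.1, p.2)] lies in the triangle; the bound is symmetric in [p] and [q]. *)
wlog pq : p q / p.1 + q.2 < 1 => [hw tp tq|].
  have [pq|pq] := ltP (p.1 + q.2) 1; first exact: hw.
  rewrite -sqrrN opprB (addeC (W p)); apply: hw => //.
  by case: tp tq => ? ? ? [? ? ?]; lra.
case: p q pq => [s t] [s' t'] /= pq [/= s0 t0 st] [/= s'0 t'0 st'].
have h1 := vert s0 (ltW t0) st (ltW t'0) pq.
have h2 := horiz t'0 (ltW s0) pq (ltW s'0) st'.
apply: (@le_trans _ _ (2%:E * (V s + H t'))%E); last first.
  rewrite lee_wpmul2l// ?lee_fin//.
  by rewrite /W /= leeD// ?leeDl ?leeDr.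
apply: (le_trans _ (lee_pmul _ _ (lexx 2%:E) (leeD h1 h2))); last 2 first.
- by rewrite lee_fin.
- by rewrite adde_ge0// lee_fin sqr_ge0.
rewrite -EFinD -EFinM lee_fin -subr_ge0.
set a := u (s, t); set b := u (s', t'); set c := u (s, t').
rewrite (_ : _ - _ = (a - 2 * c + b) ^+ 2) ?sqr_ge0//; ring.
Qed.

Let average p : tri p ->
  (\int[leb2]_(q in tri) ((u p - u q) ^+ 2)%:E <= 2%:E * (W p + E))%E.
Proof.
move=> tp.
have mT := measurable_tri.
apply: (@le_trans _ _ (\int[leb2]_(q in tri) (2%:E * (W p + W q)))%E).
  apply: ge0_le_integral => //.
  - by move=> q _; rewrite lee_fin sqr_ge0.
  - apply: measurable_funTS; apply: msq2 => q.
    by apply: cvgB; [exact: cvg_cst|exact: cu].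
  - apply: measurable_funTS; apply: emeasurable_funM => //.
    exact: emeasurable_funD.
  - by move=> q; exact: pointwise.
have mW' : measurable_fun tri W by exact: measurable_funTS.
rewrite ge0_integralZl//; last 2 first.
- by apply: emeasurable_funD.
- by move=> q _; exact: adde_ge0.
rewrite lee_wpmul2l// ?lee_fin//.
rewrite ge0_integralD// integral_cst// leeD//.
by rewrite -[leRHS]mule1 lee_wpmul2l ?W0//; exact: leb2_tri_le1.
Qed.

(** The hypothesis is a Jensen inequality for [m], left abstract because the mean will be taken over
    the actual element. The 4 comes from the 2 in [average] and from [W p] and [E] each contributing
    at most [E]. *)
Lemma tri_poincare (m k : R) : 0 <= k ->
  (forall p, tri p -> ((u p - m) ^+ 2)%:E <=
     k%:E * \int[leb2]_(q in tri) ((u p - u q) ^+ 2)%:E)%E ->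
  (\int[leb2]_(p in tri) ((u p - m) ^+ 2)%:E <=
     (4 * k)%:E * \int[leb2]_(p in tri) (us p ^+ 2 + ut p ^+ 2)%:E)%E.
Proof.
move=> k0 hm; have mT := measurable_tri.
have mW' : measurable_fun tri W by exact: measurable_funTS.
apply: (@le_trans _ _ (\int[leb2]_(p in tri) ((2 * k)%:E * (W p + E)))%E).
  apply: ge0_le_integral => //.
  - by move=> q _; rewrite lee_fin sqr_ge0.
  - apply: measurable_funTS; apply: msq2 => q.
    by apply: cvgB; [exact: cu|exact: cvg_cst].
  - apply: emeasurable_funM => //; exact: emeasurable_funD.
  - move=> p tp; apply: le_trans (hm p tp) _.
    rewrite (mulrC 2) EFinM -muleA lee_wpmul2l// ?lee_fin//; exact: average.
rewrite ge0_integralZl//; last 3 first.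
- by apply: emeasurable_funD.
- by move=> q _; exact: adde_ge0.
- by rewrite lee_fin mulr_ge0.
rewrite (_ : 4 * k = (2 * k) * 2); last by ring.
rewrite [in leRHS]EFinM -muleA lee_wpmul2l// ?lee_fin ?mulr_ge0//.
rewrite ge0_integralD// integral_cst// mule_natl mule2n leeD//.
by rewrite -[leRHS]mule1 lee_wpmul2l//; exact: leb2_tri_le1.
Qed.

Lemma tri_half_trace (c : R) :
  (\int[mu]_(s in `]0%R, 2^-1%R[) ((u (s, 0%R) - c) ^+ 2)%:E <=
   2%:E * \int[leb2]_(p in tri) (us p ^+ 2 + ut p ^+ 2)%:E +
   4%:E * \int[leb2]_(p in tri) ((u p - c) ^+ 2)%:E)%E.
Proof.
have mI : measurable (`]0%R, 2^-1%R[%classic : set R) by exact: measurable_itv.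
have mT := measurable_tri.
pose uc p := u p - c.
have cuc : continuous uc by move=> p; apply: cvgB; [exact: cu|exact: cvg_cst].
pose U s : \bar R := (\int[mu]_t sq uc (s, t))%E.
have mU : measurable_fun [set: R] U.
  by apply: tonelli_mF; [exact: measurable_sq|exact: sq_ge0].
have U0 s : (0 <= U s)%E by apply: integral_ge0 => t _.
have intU : (\int[mu]_s U s = \int[leb2]_(p in tri) ((u p - c) ^+ 2)%:E)%E.
  by rewrite [RHS]integral_mkcond;
    exact: (esym (tonelli1 (measurable_sq cuc) (sq_ge0 uc))).
have msec s : measurable_fun [set: R] (fun t => sq uc (s, t)).
  exact: measurableT_comp (measurable_sq cuc) (measurable_pair1 s).
have msec2 s : measurable_fun [set: R] (fun t => 2%:E * sq uc (s, t))%E.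
  by apply: emeasurable_funM => //; exact: msec.
have bound s : 0 < s < 2^-1 ->
    (((u (s, 0%R) - c) ^+ 2)%:E <= 2%:E * V s + 4%:E * U s)%E.
  move=> /andP[s0 s1].
  have h t : 0 < t < 2^-1 ->
      (((u (s, 0%R) - c) ^+ 2)%:E <= 2%:E * V s + 2%:E * sq uc (s, t))%E.
    move=> /andP[t0 t1].
    have st : s + t < 1 by lra.
    have h1 : (((u (s, 0%R) - u (s, t)) ^+ 2)%:E <= V s)%E.
      by apply: vert => //; rewrite ?(ltW t0)//; lra.
    have h2 : (2%:E * ((u (s, 0%R) - u (s, t)) ^+ 2)%:E <= 2%:E * V s)%E.
      by rewrite lee_wpmul2l// ?lee_fin//.
    apply: le_trans (leeD2r _ h2).
    rewrite /sq patchE mem_set//.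
    rewrite -!EFinM -EFinD lee_fin /uc -subr_ge0.
    set a := u (s, 0); set b := u (s, t).
    rewrite (_ : _ - _ = (a - 2 * b + c) ^+ 2) ?sqr_ge0//; ring.
  have half : mu `]0%R, 2^-1%R[ = (2^-1)%:E.
    by rewrite lebesgue_measure_itv /= lte_fin invr_gt0 ltr0n oppr0 adde0.
  have intc (k : \bar R) :
      (\int[mu]_(t in `]0%R, 2^-1%R[) k = k * 2^-1%:E)%E.
    by rewrite integral_cst// -half.
  (* [h] is integrated over [0 < t < 1/2], a segment inside the triangle because [s < 1/2]. Its
     length 1/2 halves the left side and the [V] term; multiplying back by 2 yields the constants 2
     and 4. *)
  have : (2^-1%:E * ((u (s, 0%R) - c) ^+ 2)%:E <= V s + 2%:E * U s)%E.
    rewrite muleC -intc.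
    apply: (@le_trans _ _ (\int[mu]_(t in `]0%R, 2^-1%R[)
        (2%:E * V s + 2%:E * sq uc (s, t)))%E).
      apply: ge0_le_integral => //.
      + by move=> t _; rewrite lee_fin sqr_ge0.
      + apply: measurable_funTS; apply: emeasurable_funD => //.
        exact: msec2.
    have m2 : measurable_fun (`]0%R,
      2^-1%R[%classic : set R) (fun t => 2%:E * sq uc (s, t))%E.
      by apply: measurable_funTS; exact: msec2.
    rewrite ge0_integralD//; last 2 first.
    + by move=> t _; rewrite mule_ge0// lee_fin.
    + by move=> t _; rewrite mule_ge0// lee_fin.
    rewrite intc ge0_integralZl//; last first.
      by apply: measurable_funTS; exact: msec.
    rewrite muleAC -EFinM divff// mul1e leeD2l// lee_wpmul2l// ?lee_fin//.
    apply: ge0_subset_integral => //; exact: msec.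
  have two0 : (0 <= 2%:E :> \bar R)%E by rewrite lee_fin.
  move=> /(lee_wpmul2l two0).
  rewrite -EFinM mulrA divff// mul1r ge0_muleDr//;
    last by rewrite mule_ge0// lee_fin.
  by rewrite muleA -EFinM (_ : 2 * 2 = 4)//; ring.
apply: (@le_trans _ _ (\int[mu]_(s in `]0%R,
  2^-1%R[) (2%:E * V s + 4%:E * U s))%E).
  apply: ge0_le_integral => //.
  - by move=> t _; rewrite lee_fin sqr_ge0.
  - apply: measurable_funTS; apply/measurable_EFinP.
    apply: continuous_measurable_fun => x.
    by apply: (cvgM (@cont1 uc 0 cuc x) (@cont1 uc 0 cuc x)).
  - by apply: measurable_funTS; apply: emeasurable_funD;
    exact: emeasurable_funM.
apply: (@le_trans _ _ (\int[mu]_s (2%:E * V s + 4%:E * U s))%E).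
  apply: ge0_subset_integral => //.
  - by apply: emeasurable_funD; exact: emeasurable_funM.
  - by move=> s _; rewrite adde_ge0// mule_ge0// lee_fin.
rewrite ge0_integralD//; last 4 first.
- by move=> s _; rewrite mule_ge0// lee_fin.
- exact: emeasurable_funM.
- by move=> s _; rewrite mule_ge0// lee_fin.
- exact: emeasurable_funM.
rewrite !ge0_integralZl// intU integral_V leeD2r// lee_wpmul2l// ?lee_fin//.
by rewrite -/E E_sum leeDl// integral_ge0// => p _; rewrite lee_fin sqr_ge0.
Qed.
End C1.
End ReferenceTriangle.

Arguments tri {R}.

(** * Derivatives along lines from continuous partial derivatives *)

Section LineDerivative.
Variable R : realType.

(** [a] and [b] come in either order because it is applied to increments of arbitrary sign. *)
Lemma mean_value (f df : R -> R) (a b : R) :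
  (forall x : R, is_derive x 1 f (df x)) ->
  exists c, `|c - a| <= `|b - a| /\ f b - f a = df c * (b - a).
Proof.
move=> hf; have cf : continuous f.
  by move=> x; apply: differentiable_continuous; apply/derivable1_diffP;
     have [] := hf x.
have mvt x y : x <= y -> exists2 c, c \in `[x, y] & f y - f x = df c * (y - x).
  move=> xy; apply: MVT_segment => //; exact: continuous_subspaceT.
case/orP: (le_total a b) => ab.
  have [c] := mvt _ _ ab; rewrite in_itv/= => /andP[ac cb] e; exists c;
    split=> //.
  by rewrite !ger0_norm ?subr_ge0// lerD2r.
have [c] := mvt _ _ ab; rewrite in_itv/= => /andP[ac cb] e; exists c;
  split=> //.
  by rewrite !ler0_norm ?subr_le0// lerN2 lerD2r.
by rewrite -opprB e -mulrN opprB.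
Qed.

Lemma is_derive_slice (w : R * R -> R) (b : bool) (x : R * R) (s : R) :
  (forall y, derivable w y (dir R b)) ->
  is_derive s 1 (fun s : R => w (x + s *: dir R b))
    (partial b w (x + s *: dir R b)).
Proof.
move=> dw.
have e : (fun h : R => h^-1 *: (((fun s : R => w (x + s *: dir R b)) \o shift s)
            (h *: 1) - w (x + s *: dir R b))) =
    (fun h : R => h^-1 *: ((w \o shift (x + s *: dir R b)) (h *: dir R b)
            - w (x + s *: dir R b))).
  apply/funext => h /=; congr (_ *: (w _ - _)).
  by rewrite [h%:A]mulr1 scalerDl addrCA.
split; last by rewrite /partial /derive e.
by rewrite /derivable e; exact: dw.
Qed.

(** [smooth] provides only partial derivatives, so the chain rule is proved by hand: the increment
    is split into a horizontal and a vertical one, each given by the mean value theorem. The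
    intermediate points converge, and the partials are continuous. *)
Lemma is_derive_line (w : R * R -> R) (x d : R * R) (t : R) :
  (forall b y, derivable w y (dir R b)) ->
  (forall b, continuous (partial b w)) ->
  is_derive t 1 (fun t : R => w (x.1 + t * d.1, x.2 + t * d.2))
    (d.1 * partial false w (x.1 + t * d.1, x.2 + t * d.2) +
     d.2 * partial true w (x.1 + t * d.1, x.2 + t * d.2)).
Proof.
move=> dw cw.
pose p1 t := x.1 + t * d.1; pose p2 t := x.2 + t * d.2.
have der1 (y s : R) : is_derive s 1 (fun s : R => w (s,
  y)) (partial false w (s, y)).
  have := @is_derive_slice w false (0, y) s (dw false).
  rewrite (_ : (0, y) + s *: dir R false = (s, y)); last first.
    by congr (_, _); rewrite /= /GRing.scale /= ?mulr1 ?mulr0 ?add0r ?addr0.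
  congr (is_derive _ _ _ _); apply/funext => r; congr w.
  by congr (_, _); rewrite /= /GRing.scale /= ?mulr1 ?mulr0 ?add0r ?addr0.
have der2 (y s : R) : is_derive s 1 (fun s : R => w (y,
  s)) (partial true w (y, s)).
  have := @is_derive_slice w true (y, 0) s (dw true).
  rewrite (_ : (y, 0) + s *: dir R true = (y, s)); last first.
    by congr (_, _); rewrite /= /GRing.scale /= ?mulr1 ?mulr0 ?add0r ?addr0.
  congr (is_derive _ _ _ _); apply/funext => r; congr w.
  by congr (_, _); rewrite /= /GRing.scale /= ?mulr1 ?mulr0 ?add0r ?addr0.
have [xi hxi] := choice (fun h =>
  mean_value (p1 t) (p1 (h + t)) (der1 (p2 (h + t)))).
have [eta heta] := choice (fun h =>
  mean_value (p2 t) (p2 (h + t)) (der2 (p1 t))).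
have p1B h : p1 (h + t) - p1 t = h * d.1 by rewrite /p1; ring.
have p2B h : p2 (h + t) - p2 t = h * d.2 by rewrite /p2; ring.
have lin (c a : R) (z : R -> R) : (forall h, `|z h - a| <= `|h * c|) ->
    z h @[h --> 0^'] --> a.
  move=> hz.
  have c0 : `|h * c| @[h --> 0^'] --> (0 : R).
    have : h * c @[h --> (0 : R)] --> 0 * c.
      by apply: cvgM; [exact: cvg_id|exact: cvg_cst].
    by move=> /cvg_norm; rewrite mul0r normr0; exact: cvg_within_filter.
  apply: (@squeeze_cvgr _ _ _ _ (fun h => a - `|h * c|)
      (fun h => a + `|h * c|)).
  - by apply: nearW => h; have := hz h; rewrite ler_distl.
  - by rewrite -[X in _ --> X]subr0; apply: cvgB => //; exact: cvg_cst.
  - by rewrite -[X in _ --> X]addr0; apply: cvgD => //; exact: cvg_cst.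
have cxi : xi h @[h --> 0^'] --> p1 t.
  by apply: (lin d.1) => h; rewrite -p1B; have [] := hxi h.
have ceta : eta h @[h --> 0^'] --> p2 t.
  by apply: (lin d.2) => h; rewrite -p2B; have [] := heta h.
have cp2 : p2 (h + t) @[h --> 0^'] --> p2 t.
  by apply: (lin d.2) => h; rewrite p2B.
set L := _ + _.
have cv : (h^-1 *: (((fun t : R => w (p1 t, p2 t)) \o shift t) (h *: 1) -
      w (p1 t, p2 t))) @[h --> 0^'] --> L.
  apply: (@cvg_trans _ (d.1 * partial false w (xi h, p2 (h + t)) +
      d.2 * partial true w (p1 t, eta h) @[h --> 0^'])); last first.
    apply: cvgD; apply: cvgM; [exact: cvg_cst| |exact: cvg_cst|].
      exact: cvg_comp_pair (cw false) cxi cp2.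
    by apply: cvg_comp_pair (cw true) _ ceta; exact: cvg_cst.
  apply: near_eq_cvg; near=> h.
  have h0 : h != 0 by near: h; exact: nbhs_dnbhs_neq.
  rewrite /= [h%:A]mulr1.
  have [_] := hxi h; have [_] := heta h; rewrite p1B p2B => e2 e1.
  rewrite (_ : w _ - w _ = (w (p1 (h + t), p2 (h + t)) - w (p1 t, p2 (h + t))) +
    (w (p1 t, p2 (h + t)) - w (p1 t, p2 t))); last by ring.
  by rewrite e1 e2 /GRing.scale /=; field.
split; last by apply/cvg_lim => //; exact: cv.
by apply/cvg_ex; exists L; exact: cv.
Unshelve. all: by end_near.
Qed.
End LineDerivative.

(** * Smooth functions on a triangle *)

Section AffineTriangle.
Variable R : realType.
Notation mu := (@lebesgue_measure R).
Notation leb2 := (@leb2 R).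

Definition aff (A B C p : R * R) : R * R :=
  (A.1 + p.1 * (B.1 - A.1) + p.2 * (C.1 - A.1),
   A.2 + p.1 * (B.2 - A.2) + p.2 * (C.2 - A.2)).

(** Twice the signed area of the triangle, and the Jacobian of [aff A B C]. *)
Definition det3 (A B C : R * R) : R :=
  (B.1 - A.1) * (C.2 - A.2) - (B.2 - A.2) * (C.1 - A.1).

(** Cramer's rule: the reference coordinates are quotients of signed areas. *)
Definition aff_inv (A B C x : R * R) : R * R :=
  (det3 A x C / det3 A B C, det3 A B x / det3 A B C).

Lemma aff_invK A B C : det3 A B C != 0 -> cancel (aff_inv A B C) (aff A B C).
Proof.
by move=> d0 [x y]; rewrite /aff /aff_inv /=; congr (_, _);
  move: d0; rewrite /det3 /= => d0; field.
Qed.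

Lemma aff_inv_K A B C : det3 A B C != 0 -> cancel (aff A B C) (aff_inv A B C).
Proof.
by move=> d0 [x y]; rewrite /aff /aff_inv /=; congr (_, _);
  move: d0; rewrite /det3 /= => d0; field.
Qed.

Lemma continuous_lin (a b c : R) :
  continuous (fun p : R * R => a + p.1 * b + p.2 * c : R).
Proof.
move=> p; apply: cvgD; [apply: cvgD|]; first exact: cvg_cst.
- by apply: cvgM; [exact: cvg_fst|exact: cvg_cst].
- by apply: cvgM; [exact: cvg_snd|exact: cvg_cst].
Qed.

Lemma continuous_aff (w : R * R -> R) A B C : continuous w ->
  continuous (w \o aff A B C).
Proof. by move=> cw p; apply: (cvg_comp_pair cw); exact: continuous_lin. Qed.

Section OnTriangle.
Variables (A B C : R * R) (D : set (R * R)).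
Hypothesis d0 : det3 A B C != 0.
Hypothesis mD : measurable D.
Hypothesis affD : forall p, D (aff A B C p) <-> tri p.

Lemma integral_aff (f : R * R -> \bar R) :
  measurable_fun D f -> (forall x, D x -> 0 <= f x)%E ->
  (\int[leb2]_(x in D) f x =
   `|det3 A B C|%:E * \int[leb2]_(p in tri) f (aff A B C p))%E.
Proof.
move=> mf f0; rewrite [LHS]integral_mkcond.
have mf' : measurable_fun [set: R * R] (f \_ D).
  exact: (measurable_restrictT _ mD).1.
have f0' x : (0 <= (f \_ D) x)%E.
  by rewrite patchE; case: ifPn => //; rewrite inE; exact: f0.
rewrite [LHS](integral_affine2 A.1 A.2 d0 mf' f0').
rewrite [in RHS]integral_mkcond.
congr (_ * _)%E; apply: eq_integral => p _; rewrite !patchE.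
congr (if _ then _ else _).
by apply/idP/idP; rewrite !inE => /affD.
Qed.

Lemma leb2_affD : leb2 D = (`|det3 A B C|%:E * leb2 tri)%E.
Proof.
have e (E : set (R * R)) : measurable E ->
  leb2 E = (\int[leb2]_(x in E) (cst 1 x))%E.
  by move=> mE; rewrite integral_cst// mul1e.
by rewrite !e//; [rewrite integral_aff|exact: measurable_tri].
Qed.

Lemma fin_leb2_tri : leb2 tri \is a fin_num.
Proof. 
by rewrite ge0_fin_numE//; apply: le_lt_trans (leb2_tri_le1 R) _; rewrite ltry.
Qed.

Lemma fine_leb2D : fine (leb2 D) = `|det3 A B C| * fine (leb2 tri).
Proof. by rewrite leb2_affD fineM// fin_leb2_tri. Qed.

Lemma fine_tri_bounds : 4^-1 <= fine (leb2 tri) <= 1.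
Proof.
have ft := fin_leb2_tri; apply/andP; split.
  by rewrite -lee_fin fineK//; exact: leb2_tri_ge.
by rewrite -lee_fin fineK//; exact: leb2_tri_le1.
Qed.

Lemma fin_leb2D : leb2 D \is a fin_num.
Proof. by rewrite leb2_affD fin_numM// fin_leb2_tri. Qed.

Lemma integrable_affD (f : R * R -> R) :
  continuous f -> leb2.-integrable D (EFin \o f).
Proof.
move=> cf; apply: measurable_bounded_integrable => //.
- by have := fin_leb2D; rewrite ge0_fin_numE.
- by apply: measurable_funTS; exact: continuous_measurable2.
(* [D] lies in the affine image of the closed unit square, on which a continuous function is
   bounded. *)
have cS : compact (`[0%R, 1%R]%classic `*` `[0%R, 1%R]%classic : set (R * R)).
  by apply: compact_setX; exact: segment_compact.
have /compact_bounded[M [Mr hM]] : compact ((f \o aff A B C) @`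
    (`[0%R, 1%R]%classic `*` `[0%R, 1%R]%classic)).
  by apply: continuous_compact cS; apply: continuous_subspaceT;
     exact: continuous_aff.
exists M; split=> // N MN x Dx /=.
apply: (hM _ MN); exists (aff_inv A B C x); last by rewrite /= aff_invK.
have : D (aff A B C (aff_inv A B C x)) by rewrite aff_invK.
case: (aff_inv A B C x) => s t /affD[/= p1 p2 p3].
by split; rewrite /= in_itv/= ?(ltW p1) ?(ltW p2)//=; lra.
Qed.

Lemma L2_continuous (w : R * R -> R) : continuous w -> L2 leb2 D w.
Proof.
move=> cw; split; first by apply: measurable_funTS;
  exact: continuous_measurable2.
by apply: (integrable_affD (f := fun x => w x ^+ 2)) => x;
  exact: (cvgM (cw x) (cw x)).
Qed.

Lemma fine_leb2D_gt0 : 0 < fine (leb2 D).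
Proof.
rewrite fine_leb2D mulr_gt0 ?normr_gt0//.
by have /andP[h _] := fine_tri_bounds; rewrite (lt_le_trans _ h).
Qed.

Lemma jensen_mean (w : R * R -> R) (c : R) : continuous w ->
  ((fine (leb2 D) * (c - mean D w) ^+ 2)%:E <=
   \int[leb2]_(q in D) ((c - w q) ^+ 2)%:E)%E.
Proof.
move=> cw; have lc : L2 leb2 D (fun q => c - w q).
  by apply: L2_continuous => q; apply: cvgB; [exact: cvg_cst|exact: cw].
rewrite L2_integral// lee_fin; apply: jensen_average => //.
- exact: fin_leb2D.
- exact: fine_leb2D_gt0.
- exact: L2_continuous.
Qed.

Variable h : R.
Hypothesis hB : (B.1 - A.1) ^+ 2 + (B.2 - A.2) ^+ 2 <= h ^+ 2.
Hypothesis hC : (C.1 - A.1) ^+ 2 + (C.2 - A.2) ^+ 2 <= h ^+ 2.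

Section Smooth.
Variable w : R * R -> R.
Hypothesis sw : smooth w.

Let g b := partial b w.
Let cw : continuous w. Proof. by have [] := sw [::]. Qed.
Let cg b : continuous (g b). Proof. by have [] := sw [:: b]. Qed.
Let dw b y : derivable w y (dir R b). Proof. by have [] := sw [::]. Qed.

Let u := w \o aff A B C.
Let us p := (B.1 - A.1) * g false (aff A B C p) + (B.2 - A.2) * g true (aff A
  B C p).
Let ut p := (C.1 - A.1) * g false (aff A B C p) + (C.2 - A.2) * g true (aff A
  B C p).

Let cu : continuous u. Proof. exact: continuous_aff. Qed.

Let cus : continuous us.
Proof.
by move=> p; apply: cvgD; apply: cvgM;
  [exact: cvg_cst|exact: (continuous_aff (@cg false))|
   exact: cvg_cst|exact: (continuous_aff (@cg true))].
Qed.

Let cut : continuous ut.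
Proof.
by move=> p; apply: cvgD; apply: cvgM;
  [exact: cvg_cst|exact: (continuous_aff (@cg false))|
   exact: cvg_cst|exact: (continuous_aff (@cg true))].
Qed.

Let hus (t s : R) : is_derive s 1 (fun s => u (s, t)) (us (s, t)).
Proof.
have := is_derive_line (A.1 + t * (C.1 - A.1), A.2 + t * (C.2 - A.2))
  (B.1 - A.1, B.2 - A.2) s dw cg.
have e s' : (A.1 + t * (C.1 - A.1) + s' * (B.1 - A.1),
   A.2 + t * (C.2 - A.2) + s' * (B.2 - A.2)) = aff A B C (s', t).
  by rewrite /aff /=; congr (_, _); ring.
rewrite /us /u /= e; congr (is_derive _ _ _ _).
by apply/funext => s' /=; rewrite e.
Qed.

Let hut (s t : R) : is_derive t 1 (fun t => u (s, t)) (ut (s, t)).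
Proof.
exact: (is_derive_line (A.1 + s * (B.1 - A.1), A.2 + s * (B.2 - A.2))
  (C.1 - A.1, C.2 - A.2) t dw cg).
Qed.

Let mgsq : measurable_fun [set: R * R]
  (fun x => (g false x ^+ 2 + g true x ^+ 2)%:E).
Proof.
apply/measurable_EFinP; apply: continuous_measurable2 => x; apply: cvgD.
  exact: (cvgM (@cg false x) (@cg false x)).
exact: (cvgM (@cg true x) (@cg true x)).
Qed.

Let G : \bar R := (\int[leb2]_(x in D) (g false x ^+ 2 + g true x ^+ 2)%:E)%E.

Let absdet_gt0 : 0 < `|det3 A B C|. Proof. by rewrite normr_gt0. Qed.

(** The reference derivatives are products of the gradient with the sides [B - A] and [C - A], each
    of length at most [h]; Cauchy-Schwarz gives [h^2] for each. The Jacobian stays on the left, so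
    no lower bound on it is needed. *)
Lemma reference_energy :
  (`|det3 A B C|%:E * \int[leb2]_(p in tri) (us p ^+ 2 + ut p ^+ 2)%:E <=
   (2 * h ^+ 2)%:E * G)%E.
Proof.
rewrite /G (integral_aff (measurable_funTS mgsq)); last first.
  by move=> x _; rewrite lee_fin addr_ge0 ?sqr_ge0.
rewrite muleCA lee_wpmul2l//.
rewrite -ge0_integralZl//; last 3 first.
- apply: measurable_funTS.
  apply: (measurable_comp_aff2 A.1 (B.1 - A.1) (C.1 - A.1) A.2 (B.2 - A.2)
    (C.2 - A.2) mgsq).
- by move=> x _; rewrite lee_fin addr_ge0 ?sqr_ge0.
- by rewrite lee_fin mulr_ge0 ?sqr_ge0.
apply: ge0_le_integral.
- exact: measurable_tri.
- by move=> x _; rewrite lee_fin addr_ge0 ?sqr_ge0.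
- apply: measurable_funTS; apply/measurable_EFinP.
  apply: continuous_measurable2 => x; apply: cvgD.
    by apply: (cvgM (@cus x) (@cus x)).
  by apply: (cvgM (@cut x) (@cut x)).
- apply: measurable_funTS; apply: emeasurable_funM => //.
  exact: (measurable_comp_aff2 A.1 (B.1 - A.1) (C.1 - A.1) A.2 (B.2 - A.2)
    (C.2 - A.2) mgsq).
move=> p _; rewrite -EFinM lee_fin /us /ut.
set a := g false _; set b := g true _.
have cs x y : (x * a + y * b) ^+ 2 <= (x ^+ 2 + y ^+ 2) * (a ^+ 2 + b ^+ 2).
  by rewrite -subr_ge0 (_ : _ - _ = (x * b - y * a) ^+ 2) ?sqr_ge0//; ring.
rewrite (_ : 2 * h ^+ 2 * _ = h ^+ 2 * (a ^+ 2 + b ^+ 2) +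
  h ^+ 2 * (a ^+ 2 + b ^+ 2)); last by ring.
by apply: lerD; apply: le_trans (cs _ _) _;
  rewrite ler_wpM2r// addr_ge0 ?sqr_ge0.
Unshelve. exact: measurable_tri.
Qed.

Lemma smooth_poincare :
  (\int[leb2]_(x in D) ((w x - mean D w) ^+ 2)%:E <= (32 * h ^+ 2)%:E * G)%E.
Proof.
set m := mean D w.
have msq (c : R) : measurable_fun [set: R * R] (fun x => ((w x - c) ^+ 2)%:E).
  have cc : continuous (fun x => w x - c).
    by move=> x; apply: cvgB; [exact: cw|exact: cvg_cst].
  apply/measurable_EFinP; apply: continuous_measurable2 => x.
  exact: (cvgM (cc x) (cc x)).
(* The Jacobian cancels between the area of [D] and the integral over [D]; the remaining area of
   [tri] is at least 1/4, hence the 4. Then [32 = (4 * 4) * 2], the last 2 from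
   [reference_energy]. *)
have key p : tri p -> (((u p - m) ^+ 2)%:E <=
     4%:E * \int[leb2]_(q in tri) ((u p - u q) ^+ 2)%:E)%E.
  move=> tp; have := jensen_mean (u p) cw.
  rewrite (integral_aff (f := fun q => ((u p - w q) ^+ 2)%:E)); last 2 first.
  - apply: measurable_funTS.
    rewrite (_ : (fun q => _) = (fun q => ((w q - u p) ^+ 2)%:E))//.
    by apply/funext => q; rewrite -sqrrN opprB.
  - by move=> q _; rewrite lee_fin sqr_ge0.
  rewrite fine_leb2D -mulrA EFinM lee_pmul2l// => H.
  have /andP[a1 a2] := fine_tri_bounds.
  have : (4%:E * (fine (leb2 tri) * (u p - m) ^+ 2)%:E <=
     4%:E * \int[leb2]_(q in tri) ((u p - u q) ^+ 2)%:E)%E.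
    by rewrite lee_wpmul2l// lee_fin.
  apply: le_trans; rewrite -EFinM lee_fin mulrA -[leLHS]mul1r ler_wpM2r
    ?sqr_ge0//.
  lra.
rewrite (integral_aff (measurable_funTS (msq m))); last first.
  by move=> x _; rewrite lee_fin sqr_ge0.
have four0 : 0 <= 4 :> R by [].
have tp := tri_poincare cu cus cut hus hut four0 key.
have nd : (0 <= `|det3 A B C|%:E)%E by rewrite lee_fin.
apply: (le_trans (lee_wpmul2l nd tp)).
rewrite muleCA (_ : 32 * h ^+ 2 = (4 * 4) * (2 * h ^+ 2)); last by ring.
rewrite [in leRHS]EFinM -muleA lee_wpmul2l ?lee_fin//.
exact: reference_energy.
Qed.

Lemma smooth_half_trace (c : R) :
  (\int[mu]_(s in `]0%R, 2^-1%R[) ((w (aff A B C (s, 0%R)) - c) ^+ 2)%:E <=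
   (4 / `|det3 A B C|)%:E *
     ((h ^+ 2)%:E * G + \int[leb2]_(x in D) ((w x - c) ^+ 2)%:E))%E.
Proof.
rewrite mulrC EFinM -muleA lee_pdivlMl//.
have ht := tri_half_trace cu cus cut hut c.
have nd : (0 <= `|det3 A B C|%:E)%E by rewrite lee_fin.
apply: (le_trans (lee_wpmul2l nd ht)).
rewrite ge0_muleDr; last 2 first.
- rewrite mule_ge0//; apply: integral_ge0 => p _.
  by rewrite lee_fin addr_ge0 ?sqr_ge0.
- by rewrite mule_ge0//; apply: integral_ge0 => p _; rewrite lee_fin sqr_ge0.
rewrite [in leRHS]ge0_muleDr; last 2 first.
- rewrite mule_ge0// ?lee_fin ?sqr_ge0//; apply: integral_ge0 => p _.
  by rewrite lee_fin addr_ge0 ?sqr_ge0.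
- by apply: integral_ge0 => p _; rewrite lee_fin sqr_ge0.
rewrite (integral_aff (f := fun x => ((w x - c) ^+ 2)%:E)); last 2 first.
- apply: measurable_funTS; apply/measurable_EFinP.
  have cc : continuous (fun x => w x - c).
    by move=> x; apply: cvgB; [exact: cw|exact: cvg_cst].
  apply: continuous_measurable2 => x.
  exact: (cvgM (cc x) (cc x)).
- by move=> p _; rewrite lee_fin sqr_ge0.
apply: leeD; last by rewrite muleCA.
rewrite muleCA [leRHS]muleA -EFinM (_ : 4 * h ^+ 2 = 2 * (2 * h ^+ 2));
  last by ring.
rewrite [in leRHS]EFinM -muleA lee_wpmul2l//.
exact: reference_energy.
Qed.
End Smooth.
End OnTriangle.

Section Trace.
Variables (A B C : R * R) (D : set (R * R)).
Hypothesis d0 : det3 A B C != 0.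
Hypothesis mD : measurable D.
Hypothesis affD : forall p, D (aff A B C p) <-> tri p.
Variable h : R.
Hypothesis hB : (B.1 - A.1) ^+ 2 + (B.2 - A.2) ^+ 2 <= h ^+ 2.
Hypothesis hC : (C.1 - A.1) ^+ 2 + (C.2 - A.2) ^+ 2 <= h ^+ 2.
Hypothesis hBC : (C.1 - B.1) ^+ 2 + (C.2 - B.2) ^+ 2 <= h ^+ 2.

Lemma det3_swap X Y Z : det3 Y X Z = - det3 X Y Z :> R.
Proof. by rewrite /det3; ring. Qed.

(* Near the vertex B the half-edge estimate degenerates, hence the second half
   of the edge is estimated with the roles of A and B exchanged. *)
Lemma smooth_trace (w : R * R -> R) (c : R) : smooth w ->
  (\int[mu]_(s in `[0%R, 1%R]) ((w (aff A B C (s, 0%R)) - c) ^+ 2)%:E <=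
   (8 / `|det3 A B C|)%:E *
     ((h ^+ 2)%:E * \int[leb2]_(x in D) (partial false w x ^+ 2 + partial true
       w x ^+ 2)%:E
      + \int[leb2]_(x in D) ((w x - c) ^+ 2)%:E))%E.
Proof.
move=> sw; have cw : continuous w by have [] := sw [::].
pose f (Y Z : R * R) (s : R) : \bar R := ((w (aff Y Z C (s, 0%R)) - c) ^+ 2)%:E.
have mf Y Z : measurable_fun [set: R] (f Y Z).
  have cc : continuous (fun s : R => w (aff Y Z C (s, 0%R)) - c).
    move=> s; apply: cvgB; last exact: cvg_cst.
    by apply: (cvg_comp_pair (w := w \o aff Y Z C));
       [exact: continuous_aff|exact: cvg_id|exact: cvg_cst].
  apply/measurable_EFinP; apply: continuous_measurable_fun => s.
  exact: (cvgM (cc s) (cc s)).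
have f0 Y Z s : (0 <= f Y Z s)%E by rewrite lee_fin sqr_ge0.
have affD' p : D (aff B A C p) <-> tri p.
  have -> : aff B A C p = aff A B C (1 - p.1 - p.2, p.2).
    by rewrite /aff /=; congr (_, _); ring.
  split=> [/affD[/= h1 h2 h3]|[h1 h2 h3]]; last apply/affD; split=> //=; lra.
have d0' : det3 B A C != 0 by rewrite det3_swap oppr_eq0.
have hA' : (A.1 - B.1) ^+ 2 + (A.2 - B.2) ^+ 2 <= h ^+ 2.
  by rewrite -(sqrrN (A.1 - _)) -(sqrrN (A.2 - _)) !opprB.
have h1 := smooth_half_trace d0 mD affD hB hC sw c.
have h2 := smooth_half_trace d0' mD affD' hA' hBC sw c.
rewrite det3_swap normrN in h2.
(* The reflection [s -> 1 - s] of the edge exchanges its endpoints. *)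
have half2 : (\int[mu]_(s in `]2^-1%R, 1%R[) f A B s =
    \int[mu]_(s in `]0%R, 2^-1%R[) f B A s)%E.
  rewrite integral_mkcond [RHS]integral_mkcond.
  have mi (I : interval R) Y Z : measurable_fun [set: R] (f Y Z \_ [set` I]).
    apply: (measurable_restrictT _ _).1; first exact: measurable_itv.
    exact: measurable_funTS.
  have n1 : -1 != 0 :> R by rewrite oppr_eq0 oner_eq0.
  rewrite (integral_affine 1 n1)//; last by move=> s; rewrite patchE; case: ifP.
  rewrite normrN normr1 mul1e; apply: eq_integral => s _; rewrite !patchE.
  rewrite /f (_ : aff A B C (1 + -1 * s, 0) = aff B A C (s, 0)); last first.
    by rewrite /aff /=; congr (_, _); ring.
  congr (if _ then _ else _); apply/idP/idP;
    rewrite !inE /= !in_itv /= => /andP[? ?];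
    apply/andP; split; lra.
rewrite -[leLHS]/(\int[mu]_(s in `[0%R, 1%R]) f A B s)%E.
rewrite (integral_itv_bndoo true false); last exact: measurable_funTS.
have U : `]0, 1[%classic = `]0, 2^-1[%classic `|` `[2^-1, 1[%classic :> set R.
  rewrite -itv_bndbnd_setU// ?bnd_simp//; lra.
rewrite U ge0_integral_setU//; last 2 first.
- by apply: measurable_funTS; exact: mf.
- by apply/disj_setPRL => s /=; rewrite !in_itv /= => /andP[s1 _]; apply/negP;
  lra.
rewrite (integral_itv_bndoo true true) ?half2; last exact: measurable_funTS.
rewrite (_ : 8 / `|det3 A B C| = 4 / `|det3 A B C| + 4 / `|det3 A B C|);
  last by lra.
rewrite EFinD ge0_muleDl; last 2 first.
- by rewrite lee_fin divr_ge0.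
- by rewrite lee_fin divr_ge0.
exact: leeD.
Qed.
End Trace.
End AffineTriangle.

(** * Passage to the limit *)

Section SobolevLimit.
Variable R : realType.
Notation mu := (@lebesgue_measure R).
Notation leb2 := (@leb2 R).
Implicit Types x y z : R * R.

Lemma enorm_sqr x : enorm x ^+ 2 = x.1 ^+ 2 + x.2 ^+ 2.
Proof.
by rewrite /enorm /dotp -!expr2 sqr_sqrtr// addr_ge0 ?sqr_ge0.
Qed.

Lemma enorm_ge0 x : 0 <= enorm x. Proof. exact: sqrtr_ge0. Qed.

Lemma enormD x y : enorm (x + y) <= enorm x + enorm y.
Proof.
rewrite -ler_sqr ?nnegrE ?addr_ge0 ?enorm_ge0// enorm_sqr [leRHS]sqrrD
  !enorm_sqr /=.
have cs : x.1 * y.1 + x.2 * y.2 <= enorm x * enorm y.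
  apply: le_trans (ler_norm _) _.
  rewrite -ler_sqr ?nnegrE ?mulr_ge0 ?enorm_ge0// exprMn !enorm_sqr real_normK
    ?num_real//.
  rewrite -subr_ge0 (_ : _ - _ = (x.1 * y.2 - x.2 * y.1) ^+ 2) ?sqr_ge0//; ring.
rewrite -subr_ge0 (_ : _ - _ =
  2 * (enorm x * enorm y - (x.1 * y.1 + x.2 * y.2))); last by ring.
by rewrite mulr_ge0// subr_ge0.
Qed.

Lemma enormB x y : enorm (x - y) = enorm (y - x).
Proof. by rewrite /enorm /dotp /=; congr Num.sqrt; ring. Qed.

Section H1.
Variables (A B C : R * R) (D : set (R * R)).
Hypothesis d0 : det3 A B C != 0.
Hypothesis mD : measurable D.
Hypothesis affD : forall p, D (aff A B C p) <-> tri p.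
Variable h : R.
Hypothesis h0 : 0 <= h.
Hypothesis hB : (B.1 - A.1) ^+ 2 + (B.2 - A.2) ^+ 2 <= h ^+ 2.
Hypothesis hC : (C.1 - A.1) ^+ 2 + (C.2 - A.2) ^+ 2 <= h ^+ 2.
Hypothesis hBC : (C.1 - B.1) ^+ 2 + (C.2 - B.2) ^+ 2 <= h ^+ 2.

Let N (f : R * R -> R) := nrm leb2 D f.
Let ne (f : R * R -> R) :=
  nrm mu `[0%R, 1%R] (fun t => f (aff A B C (t, 0))).
Let dw (w : R * R -> R) x := (partial false w x, partial true w x).

Let mD' : measurable (D : set (measurableTypeR R * measurableTypeR R)).
Proof. exact: mD. Qed.

Let mI : measurable (`[0%R, 1%R]%classic : set (measurableTypeR R)).
Proof. exact: measurable_itv. Qed.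

Lemma L2_enorm (g : R * R -> R * R) :
  L2 leb2 D (fun x => (g x).1) -> L2 leb2 D (fun x => (g x).2) ->
  L2 leb2 D (fun x => enorm (g x)).
Proof.
by move=> l1 l2; exact: (L2_sqrt_sum mD' l1 l2).
Qed.

Lemma L2_partial w b : smooth w -> L2 leb2 D (partial b w).
Proof.
by move=> sw; apply: (L2_continuous d0 mD affD); have [] := sw [:: b].
Qed.

Lemma smooth_poincare_norm w : smooth w ->
  N (fun x => w x - mean D w) <= 6 * h * N (fun x => enorm (dw w x)).
Proof.
move=> sw; have lw : L2 leb2 D w.
  by apply: (L2_continuous d0 mD affD); have [] := sw [::].
have fD := fin_leb2D d0 mD affD.
have lc := L2B mD' lw (L2_cst mD' fD (mean D w)).
have lg : L2 leb2 D (fun x => enorm (dw w x)).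
  by apply: L2_enorm; exact: L2_partial.
rewrite -ler_sqr ?nnegrE ?mulr_ge0 ?nrm_ge0//.
have := smooth_poincare d0 mD affD hB hC sw.
rewrite -(nrm_sqrE mD' lc).
under [X in (_ <= _ * X)%E -> _]eq_integral => x _.
  rewrite -(enorm_sqr (dw w x)).
  over.
rewrite -(nrm_sqrE mD' lg) -EFinM lee_fin => H.
(* [32 <= 6^2]. *)
apply: (le_trans H); rewrite !exprMn ler_wpM2r ?sqr_ge0// ler_wpM2r ?sqr_ge0//.
lra.
Qed.

Lemma L2_edge (w : R * R -> R) : continuous w ->
  L2 mu `[0%R, 1%R] (fun t => w (aff A B C (t, 0))).
Proof.
move=> cw.
have cl : continuous (fun t => w (aff A B C (t, 0))).
  move=> s; apply: (cvg_comp_pair (w := w \o aff A B C));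
    [exact: continuous_aff|exact: cvg_id|exact: cvg_cst].
have cl2 : continuous (fun t => w (aff A B C (t, 0)) ^+ 2).
  by move=> s; exact: (cvgM (cl s) (cl s)).
split; first by apply: measurable_funTS; exact: continuous_measurable_fun.
have : mu.-integrable `[0, 1] (EFin \o (fun t => w (aff A B C (t, 0)) ^+ 2)).
  apply: continuous_compact_integrable; first exact: segment_compact.
  exact: continuous_subspaceT.
by [].
Qed.

Lemma L2_edge_cst (k : R) : L2 mu `[0%R, 1%R] (fun=> k).
Proof. by apply: (@L2_edge (fun=> k)) => x; exact: cvg_cst. Qed.

Lemma smooth_trace_norm w (c : R) : smooth w ->
  ne (fun x => w x - c) <=
  Num.sqrt (8 / `|det3 A B C|) *
    (h * N (fun x => enorm (dw w x)) + N (fun x => w x - c)).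
Proof.
move=> sw; have cw : continuous w by have [] := sw [::].
have lw : L2 leb2 D w := L2_continuous d0 mD affD cw.
have fD := fin_leb2D d0 mD affD.
have lc := L2B mD' lw (L2_cst mD' fD c).
have lg : L2 leb2 D (fun x => enorm (dw w x)).
  by apply: L2_enorm; exact: L2_partial.
have le : L2 mu `[0%R, 1%R] (fun t => w (aff A B C (t, 0)) - c).
  apply: (@L2_edge (fun x => w x - c)) => x.
  by apply: cvgB; [exact: cw|exact: cvg_cst].
have s0 : 0 <= 8 / `|det3 A B C| by rewrite divr_ge0.
rewrite -ler_sqr ?nnegrE ?mulr_ge0 ?addr_ge0 ?mulr_ge0 ?nrm_ge0 ?sqrtr_ge0//.
have := smooth_trace d0 mD affD hB hC hBC c sw.
rewrite -(nrm_sqrE mD' lc) -(nrm_sqrE mI le).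
under [X in (_ <= _ * (_ * X + _))%E -> _]eq_integral => x _.
  rewrite -(enorm_sqr (dw w x)).
  over.
rewrite -(nrm_sqrE mD' lg) -!EFinM lee_fin => H.
apply: (le_trans H); rewrite [leRHS]exprMn (sqr_sqrtr s0) ler_wpM2l//.
rewrite [leRHS]sqrrD (exprMn _ h) addrAC lerDl.
by rewrite mulrn_wge0// !mulr_ge0 ?nrm_ge0.
Qed.

Lemma gradient_norm_le w (g : R * R -> R * R) : smooth w ->
  L2 leb2 D (fun x => (g x).1) -> L2 leb2 D (fun x => (g x).2) ->
  N (fun x => enorm (dw w x)) <=
  N (fun x => enorm (dw w x - g x)) + N (fun x => enorm (g x)).
Proof.
move=> sw l1 l2; have lp b := L2_partial b sw.
have lg := L2_enorm l1 l2.
have ld : L2 leb2 D (fun x => enorm (dw w x)) by apply: L2_enorm; exact: lp.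
have ldg : L2 leb2 D (fun x => enorm (dw w x - g x)).
  apply: L2_enorm; first exact: (L2B mD' (lp false) l1).
  exact: (L2B mD' (lp true) l2).
apply: le_trans (nrmD mD' ldg lg).
apply: (nrm_le mD' ld (L2D mD' ldg lg)) => x _.
rewrite ler_sqr ?nnegrE ?addr_ge0 ?enorm_ge0//.
by rewrite -{1}(subrK (g x) (dw w x)) enormD.
Qed.

Lemma le_of_cvg0 (x y : R) (e : nat -> R) :
  (forall n, x <= y + e n) -> e n @[n --> \oo] --> 0 -> x <= y.
Proof.
move=> xy e0; rewrite -(addr0 y).
have cy : (fun n => y + e n) n @[n --> \oo] --> y + 0.
  by apply: cvgD => //; exact: cvg_cst.
rewrite -(cvg_lim _ cy)//; apply: limr_ge; first by apply/cvg_ex;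
  exists (y + 0).
exact: nearW.
Qed.

Section Limit.
Variables (v : R * R -> R) (g : R * R -> R * R) (w : nat -> R * R -> R).
Hypothesis lv : L2 leb2 D v.
Hypothesis l1 : L2 leb2 D (fun x => (g x).1).
Hypothesis l2 : L2 leb2 D (fun x => (g x).2).
Hypothesis sw : forall n, smooth (w n).
Hypothesis cw : N (fun x => w n x - v x) @[n --> \oo] --> 0.
Hypothesis cg : N (fun x => enorm (dw (w n) x - g x)) @[n --> \oo] --> 0.

Let lw n : L2 leb2 D (w n).
Proof. by apply: (L2_continuous d0 mD affD); have [] := sw n [::]. Qed.

Let fD := fin_leb2D d0 mD affD.
Let D0 := fine_leb2D_gt0 d0 mD affD.
Let lk k : L2 leb2 D (fun=> k) := L2_cst mD' fD k.

Lemma h1_poincare : N (fun x => v x - mean D v) <= 12 * h * N (fun x =>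
  enorm (g x)).
Proof.
pose e n := 2 * N (fun x => w n x - v x) +
  12 * h * N (fun x => enorm (dw (w n) x - g x)).
apply: (@le_of_cvg0 _ _ e) => [n|]; last first.
  have : e n @[n --> \oo] --> 2 * 0 + 12 * h * 0.
    by apply: cvgD; (apply: cvgM; first exact: cvg_cst).
  by rewrite !mulr0 addr0.
(* The mean of [w n] stands in for that of [v]; this doubles the 6 of the smooth inequality to
   12. *)
apply: le_trans (nrm_average mD' fD D0 (mean D (w n)) lv) _.
have h1 := nrmB_le mD' lv (lw n) (lk (mean D (w n))).
have h2 := smooth_poincare_norm (sw n).
have h3 := gradient_norm_le (sw n) l1 l2.
have h4 := ler_wpM2l (mulr_ge0 (ler0n R 6) h0) h3.
rewrite (nrm_distC leb2 D v (w n)) in h1.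
move: h1 h2 h4; rewrite /e -/(N _) -/(N _) -/(N _).
set a := N _; set b := N _; set c := N _; set d := N _; set e1 := N _;
  set f := N _.
rewrite mulrDr => *; nra.
Qed.

(** The smooth trace inequality holds for any constant, so the mean of [v] is used from the start.
    [13 = 1 + 12]: the gradient itself plus the Poincare bound on [v - mean D v]. *)
Lemma h1_trace (t : R * R -> R) :
  L2 mu `[0%R, 1%R] (fun s => t (aff A B C (s, 0))) ->
  ne (fun x => w n x - t x) @[n --> \oo] --> 0 ->
  ne (fun x => t x - mean D v) <=
  Num.sqrt (8 / `|det3 A B C|) * (13 * h) * N (fun x => enorm (g x)).
Proof.
move=> lt ct; set S := Num.sqrt _.
have S0 : 0 <= S by exact: sqrtr_ge0.
pose e n := ne (fun x => w n x - t x) +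
  S * (h * N (fun x => enorm (dw (w n) x - g x)) + N (fun x => w n x - v x)).
apply: (@le_of_cvg0 _ _ e) => [n|]; last first.
  have : e n @[n --> \oo] --> 0 + S * (h * 0 + 0).
    apply: cvgD => //; apply: cvgM; first exact: cvg_cst.
    by apply: cvgD => //; apply: cvgM => //; exact: cvg_cst.
  by rewrite !(mulr0, addr0).
have lwe : L2 mu `[0%R, 1%R] (fun s => w n (aff A B C (s, 0))).
  by apply: L2_edge; have [] := sw n [::].
have lke := L2_edge_cst (mean D v).
have h1 := nrmB_le mI lt lwe lke.
have h2 := smooth_trace_norm (mean D v) (sw n).
have h3 := gradient_norm_le (sw n) l1 l2.
have h4 := nrmB_le mD' (lw n) lv (lk (mean D v)).
have h5 := h1_poincare.
rewrite (nrm_distC mu `[0%R, 1%R] (fun s => t (aff A B C (s, 0)))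
  (fun s => w n (aff A B C (s, 0)))) in h1.
have h6 : h * N (fun x => enorm (dw (w n) x)) + N (fun x => w n x - mean D v)
  <= h * (N (fun x => enorm (dw (w n) x - g x)) + N (fun x => enorm (g x))) +
     (N (fun x => w n x - v x) + 12 * h * N (fun x => enorm (g x))).
  apply: lerD; first exact: ler_wpM2l.
  by apply: le_trans h4 _; rewrite lerD2l.
apply: le_trans h1 _; rewrite /e addrCA lerD2l.
apply: le_trans h2 _; apply: (le_trans (ler_wpM2l S0 h6)).
by rewrite le_eqVlt; apply/orP; left; apply/eqP; ring.
Qed.
End Limit.
End H1.
End SobolevLimit.

(** * Geometry of triangles *)

Section TriangleGeometry.
Variable R : realType.
Notation edist := (@Defs.edist R).
Implicit Types (A B C : R * R) (H : set (R * R)).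

Lemma det3_aff A B C (p : R * R) : det3 A B (aff A B C p) = p.2 * det3 A B C.
Proof. by rewrite /det3 /aff /=; ring. Qed.

Lemma enorm_gt0 (x : R * R) : (0 < enorm x) = (x != 0).
Proof.
case: x => a b; rewrite lt_neqAle enorm_ge0 andbT eq_sym sqrtr_eq0 /dotp /=
  -!expr2.
rewrite -ltNge lt_neqAle addr_ge0 ?sqr_ge0// andbT eq_sym paddr_eq0 ?sqr_ge0//.
by rewrite !sqrf_eq0 -pair_eqE.
Qed.

Lemma enormZ (k : R) (x : R * R) : enorm (k *: x) = `|k| * enorm x.
Proof.
rewrite /enorm -sqrtr_sqr -sqrtrM ?sqr_ge0//; congr Num.sqrt.
by rewrite /dotp /= /GRing.scale /=; ring.
Qed.

Lemma det3_le A B C : `|det3 A B C| <= edist A B * edist A C.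
Proof.
rewrite /Defs.edist -ler_sqr ?nnegrE ?mulr_ge0 ?enorm_ge0// exprMn !enorm_sqr.
rewrite real_normK ?num_real// /det3 /= -subr_ge0.
rewrite (_ : _ - _ = ((A.1 - B.1) * (A.1 - C.1) + (A.2 - B.2) * (A.2 - C.2))
  ^+ 2).
  exact: sqr_ge0.
ring.
Qed.

Definition is_triangle H A B C : Prop :=
  forall x, H x <->
    exists p : R * R, [/\ 0 <= p.1, 0 <= p.2, p.1 + p.2 <= 1 & x = aff A B C p].

Lemma is_triangle_swap H A B C : is_triangle H A B C -> is_triangle H A C B.
Proof.
move=> hH x; rewrite hH; split=> -[[s t] /= [s0 t0 st ->]]; exists (t, s);
  split=> //=.
- by rewrite addrC.
- by rewrite /aff /=; congr (_, _); ring.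
- by rewrite addrC.
- by rewrite /aff /=; congr (_, _); ring.
Qed.

Section Triangle.
Variables (A B C : R * R) (H : set (R * R)).
Hypothesis hH : is_triangle H A B C.

(** A ball in [H] contains a point and its translates by [e / 2] along both axes. The determinant of
    the two translations, [(e / 2)^2], is a multiple of [det3 A B C]. *)
Lemma interior_det_neq0 : H° !=set0 -> det3 A B C != 0.
Proof.
move=> [x /nbhs_ballP[e /= e0 eH]].
have e2 : `|e / 2| < e by rewrite gtr0_norm ?divr_gt0//; lra.
have /hH[p0 [_ _ _ x0]] : H x by apply: eH; exact: ballxx.
have /hH[p1 [_ _ _ x1]] : H (x.1 + e / 2, x.2).
  by apply: eH; split; rewrite /ball /= ?subrr ?normr0// opprD addNKr normrN.
have /hH[p2 [_ _ _ x2]] : H (x.1, x.2 + e / 2).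
  by apply: eH; split; rewrite /ball /= ?subrr ?normr0// opprD addNKr normrN.
have [a1 a2] : x.1 = (aff A B C p0).1 /\ x.2 = (aff A B C p0).2 by rewrite x0.
move: x1 x2 => [b1 b2] [c1 c2]; rewrite /aff /= in a1 a2.
apply/eqP => d; suff : (e / 2) * (e / 2) = 0.
  by move/eqP; rewrite mulf_eq0 orbb gt_eqF// divr_gt0.
have u1 : e / 2 = (p1.1 - p0.1) * (B.1 - A.1) + (p1.2 - p0.2) * (C.1 - A.1) by
  lra.
have u2 : 0 = (p1.1 - p0.1) * (B.2 - A.2) + (p1.2 - p0.2) * (C.2 - A.2) by lra.
have v1 : 0 = (p2.1 - p0.1) * (B.1 - A.1) + (p2.2 - p0.2) * (C.1 - A.1) by lra.
have v2 : e / 2 = (p2.1 - p0.1) * (B.2 - A.2) + (p2.2 - p0.2) * (C.2 - A.2) by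
  lra.
transitivity (e / 2 * (e / 2) - 0 * 0); first by ring.
rewrite {1}u1 {1}v2 {1}u2 {1}v1.
transitivity (((p1.1 - p0.1) * (p2.2 - p0.2) - (p1.2 - p0.2) * (p2.1 - p0.1)) *
   det3 A B C); first by rewrite /det3; ring.
by rewrite d mulr0.
Qed.

Hypothesis d0 : det3 A B C != 0.

Lemma interior_aff p : H° (aff A B C p) <-> tri p.
Proof.
have cinv : continuous (aff_inv A B C).
  have c1 : continuous (fun x => det3 A x C / det3 A B C).
    rewrite (_ : (fun x => det3 A x C / det3 A B C) = (fun x : R * R =>
      (A.2 * C.1 - A.1 * C.2) / det3 A B C + x.1 * ((C.2 - A.2) / det3 A B C)
       + x.2 * ((A.1 - C.1) / det3 A B C))); first exact: continuous_lin.
    by apply/funext => y; rewrite {1}/det3; ring.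
  have c2 : continuous (fun x => det3 A B x / det3 A B C).
    rewrite (_ : (fun x => det3 A B x / det3 A B C) = (fun x : R * R =>
      (B.2 * A.1 - B.1 * A.2) / det3 A B C + x.1 * ((A.2 - B.2) / det3 A B C)
       + x.2 * ((B.1 - A.1) / det3 A B C))); first exact: continuous_lin.
    by apply/funext => y; rewrite {1}/det3; ring.
  by move=> x; exact: (cvg_pair (c1 x) (c2 x)).
split=> [|tp].
  rewrite /interior /= => nH.
  have caff : continuous (aff A B C).
    move=> q; apply: (cvg_pair (G := nbhs (aff A B C q).1)
      (H := nbhs (aff A B C q).2)); exact: continuous_lin.
  have /nbhs_ballP[e /= e0 eH] := caff p _ nH.
  have e2 : `|e / 2| < e by rewrite gtr0_norm ?divr_gt0//; lra.
  (* All small shifts of [p] keep its image in [H], so none of the three inequalities can be an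
     equality at [p]. *)
  have inC (a b : R) : `|a| < e -> `|b| < e ->
      [/\ 0 <= p.1 + a, 0 <= p.2 + b & p.1 + a + (p.2 + b) <= 1].
    move=> ae be; have /eH/hH : ball p e (p.1 + a, p.2 + b).
      by split; rewrite /ball /= opprD addNKr normrN.
    move=> [q [q1 q2 q3 /(congr1 (aff_inv A B C))]].
    by rewrite !(aff_inv_K d0) => qE; move: q1 q2 q3; rewrite -qE.
  have z : `|0 : R| < e by rewrite normr0.
  have ne2 : `|- (e / 2)| < e by rewrite normrN.
  have [h1 _ _] := inC _ _ ne2 z.
  have [_ h2 _] := inC _ _ z ne2.
  have [_ _ h3] := inC _ _ e2 z.
  by split; lra.
have oT : open (aff_inv A B C @^-1` tri).
  by apply: open_comp => [x _|]; [exact: cinv|exact: open_tri].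
have sub : aff_inv A B C @^-1` tri `<=` H.
  move=> x; rewrite /preimage /= => -[x1 x2 x3]; apply/hH.
  by exists (aff_inv A B C x); split; rewrite ?aff_invK ?ltW.
apply: (filterS sub); apply: open_nbhs_nbhs; split=> //.
by rewrite /preimage /= aff_inv_K.
Qed.

Lemma triangle_vertices : [/\ H A, H B & H C].
Proof.
split; apply/hH; [exists (0, 0)|exists (1, 0)|exists (0, 1)];
  (split; rewrite /= ?addr0 ?add0r ?ler01 ?lexx//);
  rewrite [LHS]surjective_pairing /aff /=; congr (_, _); ring.
Qed.

Lemma edistC (x y : R * R) : edist x y = edist y x.
Proof. exact: enormB. Qed.

Lemma edist_triangle_le x y : H x -> H y -> edist x y <= edist A B + edist A C.
Proof.
move=> /hH[p [p1 p2 p3 ->]] /hH[q [q1 q2 q3 ->]].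
have -> : edist (aff A B C p) (aff A B C q) =
    enorm ((p.1 - q.1) *: (B - A) + (p.2 - q.2) *: (C - A)).
  by rewrite /Defs.edist; congr enorm; congr (_, _);
    rewrite /aff /= /GRing.scale /=; ring.
apply: le_trans (enormD _ _) _; rewrite !enormZ -/(edist B A) -/(edist C A).
rewrite !(edistC _ A); apply: lerD.
  by rewrite -[leRHS]mul1r ler_wpM2r ?enorm_ge0// ler_norml; apply/andP;
    split; lra.
by rewrite -[leRHS]mul1r ler_wpM2r ?enorm_ge0// ler_norml; apply/andP; split;
  lra.
Qed.

Lemma edist_le_diam x y : H x -> H y -> edist x y <= diam H.
Proof.
move=> Hx Hy; apply: ub_le_sup; last by exists (x, y).
exists (edist A B + edist A C) => _ [[a b] [/= Ha Hb] <-].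
exact: edist_triangle_le.
Qed.

Lemma diam_le : diam H <= edist A B + edist A C.
Proof.
apply: ge_sup; first by have [HA _ _] := triangle_vertices;
  exists (edist A A); exists (A, A).
by move=> _ [[a b] [/= Ha Hb] <-]; exact: edist_triangle_le.
Qed.

Lemma edist_gt0 : 0 < edist A B.
Proof.
rewrite enorm_gt0 subr_eq0; apply: contra_neq d0 => <-.
by rewrite /det3 !subrr; ring.
Qed.

(* Moving from the centre of a disc of diameter [d] contained in the triangle
   in the direction normal to [AB] changes the height over [AB] by [d]. *)
Lemma disc_height c (d : R) : 0 <= d ->
  (forall x, edist c x <= d / 2 -> H x) -> d * edist A B <= `|det3 A B C|.
Proof.
move=> dge0 cH; have l0 := edist_gt0; set l := edist A B in l0 *.
have l2 : (B.1 - A.1) ^+ 2 + (B.2 - A.2) ^+ 2 = l ^+ 2.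
  by rewrite /l edistC /Defs.edist enorm_sqr.
pose k := d / 2 / l.
pose n : R * R := (- (B.2 - A.2), B.1 - A.1).
have nl : enorm n = l.
  rewrite /l edistC /Defs.edist /n /enorm /dotp /=; congr Num.sqrt; ring.
have dE : k * l = d / 2 by rewrite /k divfK// gt_eqF.
have k0 : 0 <= k by rewrite !divr_ge0// ltW.
have pt (s : R) : `|s| <= 1 -> exists t,
    [/\ 0 <= t <= 1 & det3 A B (c + (s * k) *: n) = t * det3 A B C].
  move=> s1; have /hH[[t1 t2] /= [h1 h2 h3 ->]] : H (c + (s * k) *: n).
    apply: cH; rewrite edistC /Defs.edist addrC addKr enormZ nl normrM
      (ger0_norm k0).
    rewrite -mulrA dE -[leRHS]mul1r ler_wpM2r// divr_ge0//.
  by exists t2; rewrite det3_aff; split=> //; lra.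
have [t [t01 tE]] := pt 1 ltac:(by rewrite normr1).
have [t' [t'01 t'E]] := pt (-1) ltac:(by rewrite normrN normr1).
have e : det3 A B (c + (1 * k) *: n) - det3 A B (c + (-1 * k) *: n) = d * l.
  transitivity (2 * k * ((B.1 - A.1) ^+ 2 + (B.2 - A.2) ^+ 2)).
    by rewrite /det3 /n /= /GRing.scale /=; ring.
  rewrite l2; have -> : 2 * k * l ^+ 2 = 2 * (k * l) * l by ring.
  by rewrite dE; field.
rewrite -e tE t'E -mulrBl; apply: le_trans (ler_norm _) _.
rewrite normrM -[leRHS]mul1r ler_wpM2r// ler_norml; apply/andP; split; lra.
Qed.

End Triangle.

(** Adding [disc_height] for the sides [AB] and [AC] bounds the inscribed diameter times
    [|AB| + |AC|] by twice the determinant, and [|AB| + |AC|] is at least the diameter. The absolute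
    value of [kappa] allows an arbitrary real. *)
Lemma shape_regular_det A B C H (kappa : R) : is_triangle H A B C ->
  det3 A B C != 0 -> diam H <= kappa * indiam H ->
  (diam H) ^+ 2 <= 2 * `|kappa| * `|det3 A B C|.
Proof.
move=> hH d0 hk.
have hH' := is_triangle_swap hH.
have d0' : det3 A C B != 0.
  by rewrite (_ : det3 A C B = - det3 A B C) ?oppr_eq0// /det3; ring.
have dE : `|det3 A C B| = `|det3 A B C|.
  by rewrite -normrN; congr `|_|; rewrite /det3; ring.
have [HA _ _] := triangle_vertices hH.
have ls0 : 0 < edist A B + edist A C.
  by rewrite addr_gt0// ?(edist_gt0 d0) ?(edist_gt0 d0').
pose M := 2 * `|det3 A B C| / (edist A B + edist A C).
pose S := [set d | 0 <= d /\ exists c, forall x, edist c x <= d / 2 -> H x].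
(* The degenerate disc makes the set nonempty, so its supremum obeys the upper bound [M]. *)
have S0 : S 0.
  split=> //; exists A => x; rewrite mul0r leNgt enorm_gt0 negbK subr_eq0.
  by move=> /eqP <-.
have SM d : S d -> d <= M.
  move=> [dge0 [c cH]]; rewrite /M ler_pdivlMr// mulrDr.
  have h1 := disc_height hH d0 dge0 cH.
  have h2 := disc_height hH' d0' dge0 cH.
  by rewrite dE in h2; lra.
have i_ub : indiam H <= M by apply: ge_sup => //; exists 0.
have i_ge0 : 0 <= indiam H by apply: ub_le_sup => //; exists M.
have D_ge0 : 0 <= diam H.
  by apply: le_trans (edist_le_diam hH HA HA); exact: enorm_ge0.
have hk' : diam H <= `|kappa| * indiam H.
  by apply: le_trans hk _; rewrite ler_wpM2r// ler_norm.
have iD : indiam H * diam H <= 2 * `|det3 A B C|.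
  apply: le_trans (ler_wpM2l i_ge0 (diam_le hH)) _.
  by rewrite -ler_pdivlMr.
rewrite expr2; apply: le_trans (ler_wpM2r D_ge0 hk') _.
rewrite [leRHS](_ : _ = `|kappa| * (2 * `|det3 A B C|)); last by ring.
by rewrite -mulrA ler_wpM2l.
Qed.
End TriangleGeometry.

(** * Elements of the mesh *)

Section MeshElement.
Variables (R : realType) (V : finType) (X : V -> R * R).
Notation edist := (@Defs.edist R).
Notation mu := (@lebesgue_measure R).
Notation leb2 := (@leb2 R).
Implicit Types (K e : {set V}).

Lemma sum3 (M : nmodType) (F : V -> M) (p q r : V) :
  p != q -> p != r -> q != r ->
  \sum_(x in [set p; q; r]%SET) F x = F p + F q + F r.
Proof.
move=> pq pr qr; rewrite -finset.setUA big_setU1;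
  last by rewrite !inE negb_or pq.
by rewrite big_setU1 ?big_set1 ?inE//= addrA.
Qed.

Lemma hull3_triangle (p q r : V) : p != q -> p != r -> q != r ->
  is_triangle (hull X [set p; q; r]%SET) (X p) (X q) (X r).
Proof.
move=> pq pr qr x; split=> [[w [w0]]|[[s t] /= [s0 t0 st ->]]].
  rewrite !sum3//= => w1 ->; exists (w q, w r); split=> //=.
    by rewrite -w1 -addrA lerDr.
  have -> : w p = 1 - w q - w r by rewrite -w1; ring.
  by rewrite /aff /= [LHS]surjective_pairing /= /GRing.scale /=; congr (_, _);
    ring.
exists (fun y => if y == p then 1 - s - t else if y == q then s
   else if y == r then t else 0); split.
- by move=> y; do 3?[case: ifP => _ //]; lra.
- rewrite sum3//= !eqxx [q == p]eq_sym (negPf pq) [r == p]eq_sym.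
  by rewrite (negPf pr) [r == q]eq_sym (negPf qr); ring.
- rewrite sum3//= !eqxx [q == p]eq_sym (negPf pq) [r == p]eq_sym.
  rewrite (negPf pr) [r == q]eq_sym (negPf qr).
  by rewrite /aff /= [RHS]surjective_pairing /= /GRing.scale /=; congr (_, _);
    ring.
Qed.

(** [p] and [q] follow the order of [enum], so [edge_pt] becomes the side [t = 0] of the reference
    triangle. *)
Lemma edge_frame K e : #|K| = 3 -> e \in edges_of K ->
  exists p q r, [/\ p != q, p != r, q != r, enum e = [:: p; q]
                  & K = [set p; q; r]%SET].
Proof.
move=> K3; rewrite inE => /andP[eK /eqP e2].
have : size (enum e) = 2 by rewrite -cardE.
case ee : (enum e) => [|p [|q []]]//= _.
have uq : uniq (enum e) := enum_uniq e.
have eE : e = [set p; q]%SET.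
  by apply/setP => x; rewrite -mem_enum ee !inE.
have /cards1P[r rE] : #|K :\: e| == 1.
  by rewrite cardsD (finset.setIidPr eK) K3 e2.
have re : r \notin e by have : r \in K :\: e by [rewrite rE set11];
  rewrite inE => /andP[].
exists p, q, r; split=> //.
- by move: uq; rewrite ee /= inE andbT.
- by move: re; rewrite eE !inE negb_or eq_sym => /andP[].
- by move: re; rewrite eE !inE negb_or [r == q]eq_sym => /andP[].
rewrite -eE -rE; apply/setP => x; rewrite !inE.
by have [/(fintype.subsetP eK)|] := boolP (x \in e).
Qed.

(** [52 = 13 * 4]: the 13 is that of [h1_trace], and [h^2 <= 2 |kappa| |det|] makes
    [(8 / |det|) h^2] at most [16 |kappa|]. *)
Definition trace_const (kappa : R) : R := 52 * Num.sqrt `|kappa|.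

Section Element.
Variables (K e : {set V}) (kappa : R).
Hypothesis K3 : #|K| = 3.
Hypothesis eltK : elt X K !=set0.
Hypothesis regK : diam (hull X K) <= kappa * indiam (hull X K).
Hypothesis eK : e \in edges_of K.

Lemma measurable_elt : measurable (elt X K).
Proof. by apply: open_measurable2; exact: open_interior. Qed.

Lemma element_size : [/\ leb2 (elt X K) \is a fin_num,
  0 < fine (leb2 (elt X K)),
  Num.sqrt (fine (leb2 (elt X K))) <= diam (hull X K), 0 <= diam (hull X K)
  & 0 < edge_len X e].
Proof.
have [p [q [r [pq pr qr ee KE]]]] := edge_frame K3 eK.
have tK := hull3_triangle pq pr qr; rewrite -KE in tK.
have d0 := interior_det_neq0 tK eltK.
have aK := interior_aff tK d0.
have mK := measurable_elt.
have [Hp Hq Hr] := triangle_vertices tK.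
have h0 : 0 <= diam (hull X K).
  by apply: le_trans (edist_le_diam tK Hp Hp); exact: enorm_ge0.
split=> //.
- exact: (fin_leb2D d0 mK aK).
- exact: (fine_leb2D_gt0 d0 mK aK).
- rewrite -(ger0_norm h0) -sqrtr_sqr; apply: ler_wsqrtr.
  rewrite (fine_leb2D d0 mK aK).
  have /andP[_ t1] := fine_tri_bounds R.
  apply: (@le_trans _ _ `|det3 (X p) (X q) (X r)|); first by rewrite ler_piMr.
  apply: le_trans (det3_le _ _ _) _; rewrite expr2.
  by apply: ler_pM; rewrite ?enorm_ge0// (edist_le_diam tK).
- by rewrite /edge_len /endpt ee /=; exact: (edist_gt0 d0).
Qed.

Variables (v : R * R -> R) (t : R * R -> R).
Hypothesis tv : is_trace X K e v t.

Let gK := normL2 (elt X K) (fun x => enorm (grad (elt X K) v x)).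

Lemma element_estimates :
  normL2 (elt X K) (fun x => v x - mean (elt X K) v) <=
    12 * diam (hull X K) * gK /\
  normL2e X e (fun x => t x - mean (elt X K) v) <=
    trace_const kappa * Num.sqrt (edge_len X e) * gK.
Proof.
have [p [q [r [pq pr qr ee KE]]]] := edge_frame K3 eK.
have tK := hull3_triangle pq pr qr; rewrite -KE in tK.
have d0 := interior_det_neq0 tK eltK.
have aK := interior_aff tK d0.
have mK := measurable_elt.
have [Hp Hq Hr] := triangle_vertices tK.
have [_ _ _ h0 l0] := element_size.
set h := diam _ in h0 *.
have sqd x y : hull X K x -> hull X K y ->
    (y.1 - x.1) ^+ 2 + (y.2 - x.2) ^+ 2 <= h ^+ 2.
  move=> Hx Hy; have := edist_le_diam tK Hy Hx.
  by rewrite -ler_sqr ?nnegrE ?enorm_ge0// enorm_sqr.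
have ed s : edge_pt X e s = aff (X p) (X q) (X r) (s, 0).
  rewrite /edge_pt /endpt ee /= [LHS]surjective_pairing /aff /= /GRing.scale /=.
  by congr (_, _); ring.
have [[lv hg] lt [w [sw cw cg ct]]] := tv.
(* Existence of a weak gradient, part of [inH1], excludes the default value of [xget]. *)
have [g1 g2 _] : weak_gradient (elt X K) v (grad (elt X K) v).
  exact: xgetPex hg.
have hB := sqd _ _ Hp Hq; have hC := sqd _ _ Hp Hr; have hBC := sqd _ _ Hq Hr.
split.
  exact: (h1_poincare d0 mK aK h0 hB hC lv g1 g2 sw cw cg).
have sl0 : 0 < Num.sqrt (edge_len X e) by rewrite sqrtr_gt0.
pose E (f : R * R -> R) s := f (aff (X p) (X q) (X r) (s, 0)).
have eE f : f \o edge_pt X e = E f.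
  by apply/funext => s /=; rewrite ed.
have nE f : normL2e X e f = Num.sqrt (edge_len X e) * nrm mu `[0%R, 1%R] (E f).
  rewrite /normL2e /nrm -sqrtrM ?(ltW l0)//; congr (Num.sqrt (_ * _)).
  by apply: eq_Rintegral => s _; rewrite ed.
have lt' : L2 mu `[0%R, 1%R] (E t).
  case: lt; rewrite eE => mt it; split=> //.
  have -> : (fun s => (E t s ^+ 2)%:E) = (fun s => (t (edge_pt X e s) ^+ 2)%:E).
    by apply/funext => s; rewrite ed.
  exact: it.
have ct' : nrm mu `[0%R, 1%R] (E (fun x => w n x - t x)) @[n --> \oo] --> 0.
  have -> : (fun n => nrm mu `[0%R, 1%R] (E (fun x => w n x - t x))) =
      (fun n => (Num.sqrt (edge_len X e))^-1 * normL2e X e (fun x =>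
        w n x - t x)).
    by apply/funext => n; rewrite nE mulKf// gt_eqF.
  rewrite -[X in _ --> X](mulr0 (Num.sqrt (edge_len X e))^-1).
  by apply: cvgM => //; exact: cvg_cst.
have H := h1_trace d0 mK aK h0 hB hC hBC lv g1 g2 sw cw cg lt' ct'.
rewrite nE; apply: (le_trans (ler_wpM2l (ltW sl0) H)).
rewrite /trace_const mulrA [52 * _ * _]mulrC ler_wpM2r ?sqrtr_ge0//.
rewrite ler_wpM2l ?(ltW sl0)//.
set D := `|_|; have D0 : 0 < D by rewrite normr_gt0.
have hD : h ^+ 2 <= 2 * `|kappa| * D := shape_regular_det tK d0 regK.
suff : Num.sqrt (8 / D) * h <= 4 * Num.sqrt `|kappa|.
  by move=> ?; rewrite mulrCA (_ : 52 * _ = 13 * (4 * Num.sqrt `|kappa|));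
    [lra|ring].
rewrite -ler_sqr ?nnegrE ?mulr_ge0 ?sqrtr_ge0// !exprMn !sqr_sqrtr//;
  last first.
  by rewrite divr_ge0 ?ltW.
rewrite -mulrA mulrCA ler_pdivrMl//; lra.
Qed.
End Element.
End MeshElement.

(** * Crouzeix-Raviart basis functions on an element *)

Section BasisFunctions.
Variables (R : realType) (V : finType) (X : V -> R * R).
Notation leb2 := (@leb2 R).
Implicit Types (K e : {set V}).

Lemma midpt2 (a b : V) : a != b ->
  midpt X [set a; b]%SET = 2^-1 *: (X a + X b).
Proof.
move=> ab; have : size (enum [set a; b]%SET) = 2 by rewrite -cardE cards2 ab.
have mem x : (x \in enum [set a; b]%SET) = (x == a) || (x == b).
  by rewrite mem_enum !inE.
rewrite /midpt /edge_pt /endpt.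
case ee : (enum [set a; b]%SET) mem (enum_uniq [set a; b]%SET)
  => [|x [|y []]]//= mem; rewrite inE andbT => xy _.
have half (z w : R * R) : z + 2^-1 *: (w - z) = 2^-1 *: (z + w).
  rewrite [LHS]surjective_pairing [RHS]surjective_pairing /= /GRing.scale /=.
  by congr (_, _); field.
rewrite half; have := mem y; have := mem x; rewrite !inE !eqxx ?orbT /=.
move=> /esym/orP[] /eqP xE /esym/orP[] /eqP yE; subst x y;
  rewrite ?eqxx// in xy *.
by rewrite addrC.
Qed.

Lemma closure_triangle (A B C : R * R) (H : set (R * R)) (m : R * R) :
  is_triangle H A B C -> det3 A B C != 0 ->
  0 <= m.1 -> 0 <= m.2 -> m.1 + m.2 <= 1 -> closure H° (aff A B C m).
Proof.
move=> tH d0 m1 m2 m12 U nU.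
have caff : continuous (aff A B C).
  move=> q; apply: (cvg_pair (G := nbhs (aff A B C q).1)
      (H := nbhs (aff A B C q).2)); exact: continuous_lin.
have /nbhs_ballP[e /= e0 eU] := caff m _ nU.
(* Moving [m] towards the barycentre [(1/3, 1/3)] by the fraction [k] enters the open triangle and
   changes each coordinate by less than [e]. *)
pose k := Num.min 1 (e / 2).
have k0 : 0 < k by rewrite lt_min ltr01 divr_gt0.
have k1 : k <= 1 by rewrite ge_min lexx.
have ke : k < e by rewrite gt_min; apply/orP; right; lra.
pose p := (m.1 + k * (3^-1 - m.1), m.2 + k * (3^-1 - m.2)).
exists (aff A B C p); split.
  by apply/(interior_aff tH d0); rewrite /p; split => /=; nra.
have small (x : R) : 0 <= x <= 1 -> `|x - (x + k * (3^-1 - x))| < e.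
  by move=> /andP[x0 x1]; rewrite opprD addNKr normrN ltr_norml; apply/andP;
    split; nra.
by apply: eU; split; apply: small; lra.
Qed.

(** Midpoint values are limits from inside the open element. Such a limit is unique only because [m]
    lies in the closure, which makes the filter proper. *)
Lemma affine_limit (D : set (R * R)) (f : R * R -> R) (a b c k : R) m :
  (forall x, D x -> f x = a * x.1 + b * x.2 + c) -> closure D m ->
  f x @[x --> within D (nbhs m)] --> k -> k = a * m.1 + b * m.2 + c.
Proof.
move=> fE Dm fk; have PF := within_nbhs_proper Dm.
rewrite -(cvg_lim _ fk)//; apply: cvg_lim => //.
apply: (@cvg_trans _ (a * x.1 + b * x.2 + c @[x --> within D (nbhs m)])).
  by apply: near_eq_cvg; near=> x; rewrite fE//; near: x; exact: withinT.
apply: cvg_within_filter; rewrite addrC (mulrC a) (mulrC b) addrA.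
rewrite (_ : (fun x : R * R => a * x.1 + b * x.2 + c) =
  (fun x => c + x.1 * a + x.2 * b)); first exact: continuous_lin.
by apply/funext => x; ring.
Unshelve. all: by end_near.
Qed.

Variables (T : {set {set V}}) (Omega : set (R * R)).
Variable phi : {set V} -> R * R -> R.
Hypothesis basis : nodal_basis X T Omega phi.

Section Element.
Variables (K : {set V}) (p q r : V).
Hypothesis KT : K \in T.
Hypotheses (pq : p != q) (pr : p != r) (qr : q != r).
Hypothesis KE : K = [set p; q; r]%SET.
Hypothesis eltK : elt X K !=set0.

(** An affine function is determined by its values at the three edge midpoints. Each edge of [K]
    gets [1 - 2 l], with [l] the barycentric coordinate of the opposite vertex; an edge outside [K]
    gets 0. *)
Lemma basis_formula e (s t : R) : e \in edges T ->
  tri (s, t) ->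
  phi e (aff (X p) (X q) (X r) (s, t)) =
    ([set p; q]%SET == e)%:R * (1 - 2 * t) +
    ([set p; r]%SET == e)%:R * (1 - 2 * s) +
    ([set q; r]%SET == e)%:R * (2 * s + 2 * t - 1).
Proof.
move=> eT tst.
have tK := hull3_triangle X pq pr qr; rewrite -KE in tK.
have d0 := interior_det_neq0 tK eltK.
have [[_ aff_phi _] mid_phi] := basis eT.
have [a [b [c phiE]]] := aff_phi K KT.
have edK (x y : V) : x \in K -> y \in K -> x != y ->
    [set x; y]%SET \in edges_of K.
  by move=> xK yK xy; rewrite inE cards2 xy andbT finset.subUset
    !finset.sub1set xK.
have pK : p \in K by rewrite KE !inE eqxx.
have qK : q \in K by rewrite KE !inE eqxx orbT.
have rK : r \in K by rewrite KE !inE eqxx orbT.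
have edT e' : e' \in edges_of K -> e' \in edges T.
  by move=> h; apply/bigcupP; exists K.
have val (x y : V) (m : R * R) : x \in K -> y \in K -> x != y ->
    0 <= m.1 -> 0 <= m.2 -> m.1 + m.2 <= 1 ->
    2^-1 *: (X x + X y) = aff (X p) (X q) (X r) m ->
    ([set x; y]%SET == e)%:R = a * (aff (X p) (X q) (X r) m).1 +
      b * (aff (X p) (X q) (X r) m).2 + c.
  move=> xK yK xy m1 m2 m12 mE.
  have ek := edK _ _ xK yK xy.
  have := mid_phi _ (edT _ ek) K; rewrite inE KT ek midpt2// mE => /(_ isT).
  exact: (affine_limit phiE (closure_triangle tK d0 m1 m2 m12)).
have h2 : (0 <= 2^-1 :> R) by rewrite invr_ge0.
have v1 := val p q (2^-1, 0) pK qK pq h2 (lexx 0).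
have v2 := val p r (0, 2^-1) pK rK pr (lexx 0) h2.
have v3 := val q r (2^-1, 2^-1) qK rK qr h2 h2.
rewrite phiE; last by apply/(interior_aff tK d0).
have pairE (x y : R * R) : x.1 = y.1 -> x.2 = y.2 -> x = y.
  by case: x y => [? ?] [? ?] /= -> ->.
rewrite v1 ?v2 ?v3; first by rewrite /aff /=; field.
all: try by apply: pairE; rewrite /aff /= /GRing.scale /=; field.
all: rewrite /=; lra.
Qed.

Lemma edges_distinct :
  [/\ [set p; q]%SET != [set p; r]%SET, [set p; q]%SET != [set q; r]%SET
    & [set p; r]%SET != [set q; r]%SET].
Proof.
split; apply/eqP => /setP.
- by move=> /(_ r); rewrite !inE eqxx orbT [r == p]eq_sym [r == q]eq_sym
    (negPf pr) (negPf qr).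
- by move=> /(_ p); rewrite !inE eqxx (negPf pq) (negPf pr).
- by move=> /(_ p); rewrite !inE eqxx (negPf pq) (negPf pr).
Qed.

Lemma edges3_in : [/\ [set p; q]%SET \in edges_of K,
  [set p; r]%SET \in edges_of K & [set q; r]%SET \in edges_of K].
Proof.
by rewrite !inE !cards2 pq pr qr !finset.subUset !finset.sub1set KE !inE !eqxx
  !orbT.
Qed.

Lemma elt_tri x : elt X K x -> exists s t, tri (s, t) /\
  x = aff (X p) (X q) (X r) (s, t).
Proof.
have tK := hull3_triangle X pq pr qr; rewrite -KE in tK.
have d0 := interior_det_neq0 tK eltK.
move=> Kx; exists (aff_inv (X p) (X q) (X r) x).1,
  (aff_inv (X p) (X q) (X r) x).2.
rewrite -surjective_pairing aff_invK//; split=> //.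
by apply/(interior_aff tK d0); rewrite aff_invK.
Qed.

End Element.

Section Element2.
Variable K : {set V}.
Hypothesis KT : K \in T.
Hypothesis K3 : #|K| = 3.
Hypothesis eltK : elt X K !=set0.

Lemma card_edges : #|edges_of K| = 3.
Proof. by rewrite /edges_of cards_draws K3. Qed.

Lemma edges_of_neq0 : exists e, e \in edges_of K.
Proof. by apply/set0Pn; rewrite -card_gt0 card_edges. Qed.

Lemma edges_of_sub e : e \in edges_of K -> e \in edges T.
Proof. by move=> eK; apply/bigcupP; exists K. Qed.

Lemma element_vertices : exists p q r,
  [/\ p != q, p != r, q != r & K = [set p; q; r]%SET].
Proof.
have [e eK] := edges_of_neq0.
by have [p [q [r [pq pr qr _ KE]]]] := edge_frame K3 eK; exists p, q, r.
Qed.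

Lemma basis_sum x : elt X K x -> \sum_(e in edges_of K) phi e x = 1.
Proof.
have [p [q [r [pq pr qr KE]]]] := element_vertices.
move=> /(elt_tri pq pr qr KE eltK)[s [t [tst ->]]].
rewrite (eq_bigr _ (fun e eK => basis_formula KT pq pr qr KE eltK
  (edges_of_sub eK) tst)) !big_split /=.
have ind (e0 : {set V}) (k : R) : e0 \in edges_of K ->
    \sum_(e in edges_of K) (e0 == e)%:R * k = k.
  move=> e0K; rewrite (bigD1 e0)//= eqxx mul1r big1 ?addr0// => e /andP[_ ne].
  by rewrite eq_sym (negPf ne) mul0r.
have [e1 e2 e3] := edges3_in pq pr qr KE.
by rewrite !ind//; ring.
Qed.

Lemma basis_bound e x : e \in edges T -> elt X K x -> phi e x ^+ 2 <= 1.
Proof.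
have [p [q [r [pq pr qr KE]]]] := element_vertices.
move=> eT /(elt_tri pq pr qr KE eltK)[s [t [tst ->]]].
rewrite (basis_formula KT pq pr qr KE eltK eT tst).
case: tst => /= s0 t0 st; have [n1 n2 n3] := edges_distinct pq pr qr.
have sq1 (y : R) : -1 <= y <= 1 -> y ^+ 2 <= 1.
  by move=> /andP[y1 y2]; rewrite -subr_ge0 (_ : _ - _ = (1 - y) * (1 + y));
     [rewrite mulr_ge0//; lra|ring].
apply: sq1; have [<-|_] := eqVneq [set p; q]%SET e.
  rewrite ![_ == [set p;
    q]%SET]eq_sym (negPf n1) (negPf n2) /= mul1r !mul0r !addr0.
  by apply/andP; split; lra.
rewrite mul0r add0r; have [<-|_] := eqVneq [set p; r]%SET e.
  rewrite [_ == [set p; r]%SET]eq_sym (negPf n3) /= mul1r mul0r addr0.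
  by apply/andP; split; lra.
rewrite mul0r add0r.
by case: eqP => _; rewrite /= ?mul1r ?mul0r; apply/andP; split; lra.
Qed.

Lemma basis_outside e x : e \in edges T -> e \notin edges_of K -> elt X K x ->
  phi e x = 0.
Proof.
have [p [q [r [pq pr qr KE]]]] := element_vertices.
move=> eT eK /(elt_tri pq pr qr KE eltK)[s [t [tst ->]]].
rewrite (basis_formula KT pq pr qr KE eltK eT tst).
have [e1 e2 e3] := edges3_in pq pr qr KE.
have ne e0 : e0 \in edges_of K -> (e0 == e) = false.
  by move=> e0K; apply: contraNF eK => /eqP <-.
by rewrite !ne// !mul0r !addr0.
Qed.

Lemma basis_L2 e : e \in edges T -> L2 leb2 (elt X K) (phi e).
Proof.
move=> eT; have [e0 e0K] := edges_of_neq0.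
have [fD _ _ _ _] := element_size K3 eltK e0K.
have mK : measurable (elt X K : set (measurableTypeR R * measurableTypeR R)).
  exact: measurable_elt.
have [[_ aff_phi _] _] := basis eT.
have [a [b [c phiE]]] := aff_phi K KT.
apply: (L2_le (g := fun=> 1) mK) => [|| x Kx]; last 2 first.
- exact: L2_cst.
- by rewrite expr1n; exact: basis_bound.
apply: (eq_measurable_fun (fun x : R * R => c + x.1 * a + x.2 * b)).
  by move=> x; rewrite inE => Kx; rewrite phiE//; ring.
by apply: measurable_funTS; apply: continuous_measurable2;
  exact: continuous_lin.
Qed.

End Element2.
End BasisFunctions.

(** * Comparison of means across an edge and the final estimates *)

Section Assembly.
Variables (R : realType) (V : finType) (X : V -> R * R).
Notation mu := (@lebesgue_measure R).
Notation leb2 := (@leb2 R).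
Notation gnorm K v := (normL2 (elt X K) (fun x => enorm (grad (elt X K) v x))).

Lemma trace_const_ge0 (kappa : R) : 0 <= trace_const kappa.
Proof. by rewrite mulr_ge0// sqrtr_ge0. Qed.

Lemma normL2eE (e : {set V}) (f : R * R -> R) : 0 <= edge_len X e ->
  normL2e X e f =
  Num.sqrt (edge_len X e) * nrm mu `[0%R, 1%R] (fun s => f (edge_pt X e s)).
Proof. by move=> l0; rewrite /normL2e sqrtrM. Qed.

Lemma mean_jump (K K' e : {set V}) (kappa : R) (v t t' : R * R -> R) :
  #|K| = 3 -> #|K'| = 3 -> elt X K !=set0 -> elt X K' !=set0 ->
  diam (hull X K) <= kappa * indiam (hull X K) ->
  diam (hull X K') <= kappa * indiam (hull X K') ->
  e \in edges_of K -> e \in edges_of K' ->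
  is_trace X K e v t -> is_trace X K' e v t' ->
  `|mean (elt X K) v - mean (elt X K') v| <=
  trace_const kappa * (gnorm K v + gnorm K' v) +
  nrm mu `[0%R, 1%R] (fun s => t' (edge_pt X e s) - t (edge_pt X e s)).
Proof.
move=> K3 K'3 nK nK' rK rK' eK eK' tK tK'.
have [_ _ _ _ l0] := element_size K3 nK eK.
have sl : 0 < Num.sqrt (edge_len X e) by rewrite sqrtr_gt0.
pose ne (f : R * R -> R) := nrm mu `[0%R, 1%R] (fun s => f (edge_pt X e s)).
have neE f y : normL2e X e f <= trace_const kappa * Num.sqrt (edge_len X e) *
  y ->
    ne f <= trace_const kappa * y.
  rewrite (normL2eE f (ltW l0)) => H; rewrite -(ler_pM2l sl).
  by apply: (le_trans H); rewrite mulrA [_ * Num.sqrt _]mulrC.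
have [_ /neE h] := element_estimates K3 nK rK eK tK.
have [_ /neE h'] := element_estimates K'3 nK' rK' eK' tK'.
have mI : measurable (`[0%R, 1%R]%classic : set (measurableTypeR R)).
  exact: measurable_itv.
have fI : (mu `[0%R, 1%R] = 1)%E.
  by rewrite lebesgue_measure_itv /= lte_fin ltr01 oppr0 adde0.
have fI' : mu `[0%R, 1%R] \is a fin_num by rewrite fI.
pose E (f : R * R -> R) (s : R) := f (edge_pt X e s).
have lt : L2 mu `[0%R, 1%R] (E t) by case: tK => _ [].
have lt' : L2 mu `[0%R, 1%R] (E t') by case: tK' => _ [].
set m := mean (elt X K) v in h *; set m' := mean (elt X K') v in h' *.
have lm : L2 mu `[0%R, 1%R] (fun=> m) by exact: L2_cst.
have lm' : L2 mu `[0%R, 1%R] (fun=> m') by exact: L2_cst.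
(* The parameter interval has measure 1, so the difference of means is itself a norm on the edge,
   and the triangle inequality can pass through the two traces. *)
have -> : `|m - m'| = nrm mu `[0%R, 1%R] (fun=> m - m').
  rewrite nrm_cst// (_ : fine _ = 1); first by rewrite sqrtr1 mulr1.
  by transitivity (fine (1%E : \bar R)) => //; congr fine; exact: fI.
apply: le_trans (nrmB_le mI lm lt lm') _.
have h2 := nrmB_le mI lt lt' lm'.
rewrite (nrm_distC mu `[0%R, 1%R] (fun=> m) (E t)).
rewrite (nrm_distC mu `[0%R, 1%R] (E t) (E t')) in h2.
apply: le_trans (lerD h h2) _.
by rewrite mulrDr -addrA lerD2l [leRHS]addrC lerD2l.
Qed.

Lemma weighted_gradient_norm (alpha : R * R -> R) (a : R) (K : {set V}) v :
  measurable (elt X K) -> inH1 (elt X K) v ->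
  (forall x, elt X K x -> alpha x = a) ->
  normL2 (elt X K) (fun x => Num.sqrt (alpha x) * enorm (grad (elt X K) v x)) =
  Num.sqrt a * gnorm K v.
Proof.
move=> mK [_ hg] aE.
have [g1 g2 _] : weak_gradient (elt X K) v (grad (elt X K) v).
  exact: xgetPex hg.
have mK' : measurable (elt X K : set (measurableTypeR R * measurableTypeR R)).
  exact: mK.
have lg := L2_enorm mK g1 g2.
have := nrmZ mK' (Num.sqrt a) lg.
rewrite ger0_norm ?sqrtr_ge0// => <-.
congr Num.sqrt; apply: eq_Rintegral => x; rewrite inE => Kx.
by rewrite aE.
Qed.
End Assembly.

Theorem lemma4p1 (R : realType) (kappa : R) :
  exists2 C : R, 0 < C &
  forall (Omega GammaD GammaN : set (R * R))
    (n : nat) (P : 'I_n -> set (R * R)) (alpha : R * R -> R)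
    (V : finType) (X : V -> R * R) (T : {set {set V}})
    (alphaK : {set V} -> R) (Kp Km : {set V} -> {set V})
    (gD : R * R -> R) (phi : {set V} -> R * R -> R),
  polygonal_domain Omega -> lipschitz_domain Omega ->
  boundary_split Omega GammaD GammaN ->
  polygonal_partition Omega P -> piecewise_constant Omega P alpha ->
  conforming_triangulation X T Omega -> shape_regular X T kappa ->
  (forall K, K \in T -> exists i, elt X K `<=` P i) ->
  (forall K, K \in T -> forall x, elt X K x -> alpha x = alphaK K) ->
  (forall e, e \in edges_bd X T Omega ->
     e \in edges_D X T Omega GammaD \/ e \in edges_N X T Omega GammaN) ->
  edge_labelling X T Omega alphaK Kp Km ->
  (forall e, e \in edges_D X T Omega GammaD -> inL2e X e gD) ->
  nodal_basis X T Omega phi ->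
  forall (v : R * R -> R) (tr : {set V} -> {set V} -> R * R -> R),
  inH1_broken X T Omega v ->
  (forall K e, K \in T -> e \in edges_of K -> is_trace X K e v (tr K e)) ->
  (forall K, K \in T ->
     normL2 (elt X K) (fun x => v x - interp X T Kp phi v x) <=
     C * (diam (hull X K) / Num.sqrt (alphaK K)) *
       (energy X alpha (elt_patch T K) v +
        \sum_(e in edges_of K)
          Num.sqrt (alphaK (Km e) / edge_len X e) *
          normL2e X e (jump X T Omega GammaD Kp Km gD tr e))) /\
  (forall e, e \in edges T ->
     normL2e X e (fun x => tr (Kp e) e x - pi_edge X Kp v e) <=
     C * Num.sqrt (edge_len X e / alphaK (Kp e)) *
       energy X alpha [set Kp e]%SET v).
Proof.
have c0 := trace_const_ge0 kappa; set c := trace_const kappa in c0.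
(* 12 is the Poincare constant; [6 * c] counts three edges, each with the trace errors of two
   elements. *)
exists (12 + 6 * c); first by rewrite ltr_wpDr// mulr_ge0.
move=> Omega GammaD GammaN n P alpha V X T alphaK Kp Km gD phi.
move=> _ _ _ [hP _ _] [alpha0 _] [conf _ _] reg sub alphaE _ [labI labB] _
  basis.
move=> v tr [_ vH1] trv.
have K3 K (KT : K \in T) := (conf K KT).1.
have nK K (KT : K \in T) := (conf K KT).2.
(* A nonempty element lies in a subdomain of [Omega], where [alpha] is positive. *)
have a0 K : K \in T -> 0 < alphaK K.
  move=> KT; have [x Kx] := nK K KT; have [i Ki] := sub K KT.
  by rewrite -(alphaE K KT x Kx); apply: alpha0; apply: (hP i).2; exact: Ki.
pose g K := normL2 (elt X K) (fun x => enorm (grad (elt X K) v x)).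
have g0 K : 0 <= g K by exact: sqrtr_ge0.
have enE K (KT : K \in T) : normL2 (elt X K)
    (fun x => Num.sqrt (alpha x) * enorm (grad (elt X K) v x)) =
    Num.sqrt (alphaK K) * g K.
  by apply: weighted_gradient_norm;
    [exact: measurable_elt|exact: vH1|exact: alphaE].
have lab K e : K \in T -> e \in edges_of K ->
  [/\ Kp e \in T, e \in edges_of (Kp e)
    & K = Kp e \/ [/\ K = Km e, e \in edges_I X T Omega
                    & alphaK K <= alphaK (Kp e)]].
  move=> KT eK; have eT := edges_of_sub KT eK.
  have Kat : K \in elts_at T e by rewrite inE KT.
  have [eb|eb] := boolP (e \in edges_bd X T Omega).
    have [ate _] := labB e eb.
    have : Kp e \in elts_at T e by rewrite ate set11.
    rewrite inE => /andP[pT pe]; split=> //; left.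
    by move: Kat; rewrite ate inE => /eqP.
  have eI : e \in edges_I X T Omega by rewrite inE eb eT.
  have [ate _ ale] := labI e eI.
  have : Kp e \in elts_at T e by rewrite ate !inE eqxx.
  rewrite inE => /andP[pT pe]; split=> //.
  move: Kat; rewrite ate in_set2 => /orP[] /eqP ->; first by left.
  by right; split.
split; last first.
  (* The second estimate is the trace inequality on [Kp e]: its energy involves this single element,
     so the coefficient cancels. *)
  move=> e /bigcupP[K KT eK]; have [pT pe _] := lab K e KT eK.
  have [_ H] := element_estimates (K3 _ pT) (nK _ pT) (reg _ pT) pe (trv _ _
    pT pe).
  have [_ _ _ _ l0] := element_size (K3 _ pT) (nK _ pT) pe.
  apply: (le_trans H); rewrite /energy big_set1 enE// sqrtr_sqr.
  rewrite ger0_norm ?mulr_ge0 ?sqrtr_ge0// -/c -/(g _).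
  have sa : 0 < Num.sqrt (alphaK (Kp e)) by rewrite sqrtr_gt0 a0.
  rewrite sqrtrM ?(ltW l0)// sqrtrV ?(ltW (a0 _ pT))//.
  set l := Num.sqrt (edge_len X e).
  have -> : (12 + 6 * c) * (l / Num.sqrt (alphaK (Kp e))) *
      (Num.sqrt (alphaK (Kp e)) * g (Kp e)) = (12 + 6 * c) * l * g (Kp e).
    by field; rewrite gt_eqF.
  rewrite ler_wpM2r// ler_wpM2r ?sqrtr_ge0//; lra.
move=> K KT.
have [e0 e0K] := edges_of_neq0 (K3 K KT).
have [fD D0 Dh h0 _] := element_size (K3 K KT) (nK K KT) e0K.
set h := diam _ in Dh h0 *.
have mK : measurable (elt X K : set (measurableTypeR R * measurableTypeR R)).
  exact: measurable_elt.
have sa : 0 < Num.sqrt (alphaK K) by rewrite sqrtr_gt0 a0.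
pose E := energy X alpha (elt_patch T K) v.
have E0 : 0 <= E by exact: sqrtr_ge0.
have gE K' : K' \in elt_patch T K -> Num.sqrt (alphaK K') * g K' <= E.
  move=> K'p; have K'T : K' \in T by move: K'p; rewrite inE => /andP[].
  rewrite -enE// -[leLHS]ger0_norm ?sqrtr_ge0// -sqrtr_sqr; apply: ler_wsqrtr.
  rewrite (bigD1 K')//= lerDl sumr_ge0// => ? _; exact: sqr_ge0.
have patch e K' : e \in edges_of K -> K' \in T -> e \in edges_of K' ->
    K' \in elt_patch T K.
  by move=> eK K'T eK'; rewrite inE K'T; apply/existsP; exists e; rewrite eK.
have gKE : g K <= E / Num.sqrt (alphaK K).
  by rewrite ler_pdivlMr// mulrC gE// (patch e0).
pose J e := Num.sqrt (alphaK (Km e) / edge_len X e) *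
  normL2e X e (jump X T Omega GammaD Kp Km gD tr e).
have J0 e : 0 <= J e by rewrite mulr_ge0 ?sqrtr_ge0.
pose m := mean (elt X K) v.
have meanE e : e \in edges_of K ->
    `|m - pi_edge X Kp v e| <= (2 * c * E + J e) / Num.sqrt (alphaK K).
  move=> eK; have [pT pe [KpE|[KmE eI ale]]] := lab K e KT eK.
    rewrite /pi_edge -KpE subrr normr0 divr_ge0 ?(ltW sa)//.
    by rewrite addr_ge0// !mulr_ge0.
  have [_ _ _ _ l0] := element_size (K3 K KT) (nK K KT) eK.
  have := mean_jump (K3 _ KT) (K3 _ pT) (nK _ KT) (nK _ pT) (reg _ KT) (reg _
    pT)
    eK pe (trv _ _ KT eK) (trv _ _ pT pe).
  rewrite -/c -/(g _) -/(g _); set j := nrm _ _ _ => H.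
  (* The edge length in the weight cancels the one in the arc length norm. *)
  have JE : J e = Num.sqrt (alphaK K) * j.
    rewrite /J normL2eE ?(ltW l0)// -KmE sqrtrM ?(ltW (a0 _ KT))//.
    have sl : 0 < Num.sqrt (edge_len X e) by rewrite sqrtr_gt0.
    rewrite sqrtrV ?(ltW l0)// mulrA (divfK (lt0r_neq0 sl)); congr (_ * _).
    rewrite /j /nrm; congr Num.sqrt; apply: eq_Rintegral => s _.
    by rewrite /jump eI -KmE.
  (* The choice of the larger coefficient acts here: the neighbour's gradient, weighted by the
     smaller [alphaK K], is still below its own energy. *)
  have gpE : g (Kp e) <= E / Num.sqrt (alphaK K).
    rewrite ler_pdivlMr// mulrC; apply: le_trans (gE _ (patch _ _ eK pT pe)).
    by rewrite ler_wpM2r// ler_wsqrtr.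
  apply: (le_trans H).
  rewrite JE mulrDl [Num.sqrt _ * j]mulrC mulfK ?gt_eqF// lerD2r.
  rewrite (_ : 2 * c * E / _ = c * (E / Num.sqrt (alphaK K) + E / Num.sqrt
    (alphaK K))).
    by apply: (ler_wpM2l c0); exact: (lerD gKE gpE).
  by ring.
have I_E x : elt X K x -> v x - interp X T Kp phi v x =
    (v x - m) + \sum_(e in edges_of K) (m - pi_edge X Kp v e) * phi e x.
  move=> Kx; have s1 := basis_sum basis KT (K3 _ KT) (nK _ KT) Kx.
  have -> : \sum_(e in edges_of K) (m - pi_edge X Kp v e) * phi e x =
      m - \sum_(e in edges_of K) pi_edge X Kp v e * phi e x.
    rewrite -[X in X - _]mulr1 -s1 mulr_sumr -sumrB.
    by apply: eq_bigr => e _; rewrite mulrBl.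
  rewrite addrA subrK; congr (_ - _).
  rewrite /interp (bigID (mem (edges_of K)))/= [X in _ + X]big1 ?addr0;
    last first.
    move=> e /andP[eT eK].
    by rewrite (basis_outside basis KT (K3 _ KT) (nK _ KT) eT eK Kx) mulr0.
  apply: eq_bigl => e; apply/andP/idP => [[]//|eK].
  by split=> //; apply/bigcupP; exists K.
have -> : normL2 (elt X K) (fun x => v x - interp X T Kp phi v x) =
    nrm (@leb2 R) (elt X K) (fun x => (v x - m) +
      \sum_(e in edges_of K) (m - pi_edge X Kp v e) * phi e x).
  congr Num.sqrt; apply: eq_Rintegral => x; rewrite inE => Kx.
  by rewrite I_E.
have [lv _] := vH1 K KT.
have lm : L2 (@leb2 R) (elt X K) (fun x =>
  v x - m) := L2B mK lv (L2_cst mK fD m).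
have lphi e (eK : e \in edges_of K) : L2 (@leb2 R) (elt X K) (phi e).
  exact: (basis_L2 basis KT (K3 _ KT) (nK _ KT) (edges_of_sub KT eK)).
have [ls sum_le] := nrm_sum mK (fun e eK =>
  L2Z mK (m - pi_edge X Kp v e) (lphi e eK))
  (L2_cst mK fD 0).
apply: (le_trans (nrmD mK lm ls)).
have [poinc _] := element_estimates (K3 _ KT) (nK _ KT) (reg _ KT) e0K (trv _
  _ KT e0K).
(* Since [phi e] is bounded by 1 on [K], its norm is at most the square root of the area, hence at
   most [h]. *)
have term e : e \in edges_of K ->
    nrm (@leb2 R) (elt X K) (fun x => (m - pi_edge X Kp v e) * phi e x) <=
    (2 * c * E + J e) / Num.sqrt (alphaK K) * h.
  move=> eK; rewrite (nrmZ mK _ (lphi e eK)); apply: ler_pM => //.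
    exact: nrm_ge0.
    exact: meanE.
  apply: le_trans Dh; have := nrm_cst (@leb2 R) mK 1.
  rewrite normr1 mul1r => <-;
    apply: (nrm_le mK (lphi e eK) (L2_cst mK fD 1)) => x Kx.
  rewrite expr1n.
  exact: (basis_bound basis KT (K3 _ KT) (nK _ KT) (edges_of_sub KT eK) Kx).
have sum_bound : \sum_(e in edges_of K)
      nrm (@leb2 R) (elt X K) (fun x => (m - pi_edge X Kp v e) * phi e x) <=
    \sum_(e in edges_of K) (2 * c * E + J e) / Num.sqrt (alphaK K) * h.
  by apply: ler_sum => e eK; exact: term.
have total := lerD poinc (le_trans sum_le sum_bound).
apply: (le_trans total).
rewrite -mulr_suml -mulr_suml big_split /= sumr_const (card_edges (K3 _ KT)).
rewrite -/h -/(g K) -/E.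
set S := \sum_(e in _) J e.
have S0 : 0 <= S by apply: sumr_ge0.
have hs0 : 0 <= h / Num.sqrt (alphaK K) by rewrite divr_ge0 ?(ltW sa).
apply: (@le_trans _ _ (12 * (h / Num.sqrt (alphaK K)) * E +
    h / Num.sqrt (alphaK K) * (6 * c * E + S))).
  apply: lerD.
    rewrite -(mulrA 12 h) -(mulrA 12 (h / _)) ler_wpM2l// -mulrA ler_wpM2l//.
    by rewrite mulrC.
  by rewrite le_eqVlt; apply/orP; left; apply/eqP; rewrite -mulr_natr; ring.
(* The jump sum [S] has coefficient 1 so far; the remaining [11 + 6 * c] is slack from using one
   constant for both terms. *)
have -> : (12 + 6 * c) * (h / Num.sqrt (alphaK K)) * (E + S) =
   12 * (h / Num.sqrt (alphaK K)) * E + h / Num.sqrt (alphaK K) * (6 * c * E +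
     S) +
   (11 + 6 * c) * (h / Num.sqrt (alphaK K)) * S by ring.
by rewrite lerDl !mulr_ge0// addr_ge0// mulr_ge0.
Qed.
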